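(* Let $G$ be the group of a virtual knot in J. Green's table. If $G$ is left-orderable, then $G$ is isomorphic to $\mathbb{Z}$, $G_1$, $G_4$, $G_7$ or $G_9$. Otherwise, $G$ is not circularly orderable and it is isomorphic to $G_2$, $G_3$, $G_5$, $G_6$ or $G_8$.
   Context: A group $G$ is left-orderable if it admits a total order $<$ such that $g_1<g_2 \Leftrightarrow hg_1<hg_2$ for all $h,g_1,g_2\in G$. A group $G$ is circularly orderable if there is a map $c: G^3\to\mathbb{Z}$ such that: (1) $c$ takes values in $\{-1,0,1\}$; (2) $c(g_1,g_2,g_3)=0$ if and only if $g_i=g_j$ for some $i\neq j$; (3) $c(g_2,g_3,g_4)-c(g_1,g_3,g_4)+c(g_1,g_2,g_4)-c(g_1,g_2,g_3)=0$ for all $g_1,\dots,g_4\in G$; (4) $c(g_1,g_2,g_3)=c(hg_1,hg_2,hg_3)$ for all $h,g_1,g_2,g_3\in G$. A virtual knot is an equivalence class of virtual knot diagrams (planar 4-regular diagrams with classical and virtual crossings). The group of a virtual knot $K$ is defined from any diagram $D$ of $K$: one generator for each arc of $D$ (arcs run from one classical undercrossing to the next, passing through virtual crossings), and at each classical crossing the usual Wirtinger conjugation relation, stating that the two under-arcs are conjugate by the over-arc (the direction of conjugation determined by the crossing); virtual crossings give no relation. The result does not depend on $D$ up to isomorphism. J. Green's table is the standard table of virtual knots with few classical crossings (J. Green, ''A table of virtual knots''). The groups of the virtual knots in this table were computed by A. Ichimori: each is isomorphic either to the infinite cyclic group $\mathbb{Z}$ or to one of the following groups $G_i$: $G_1=\langle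 x, y \mid x y x=y x y\rangle$, $G_2=\langle x, a \mid x^{-1} a x=a^{-1}, a^3 = 1\rangle$, $G_3=\langle x, y \mid x y x=y x y, y=x^{-3} y x^3\rangle$, $G_4=\langle x, y \mid x^{-1} y x y^{-1} x=y x^{-1} y x y^{-1}\rangle$, $G_5=\langle x, a \mid x^{-1} a x=a^{-1}, a^5=1\rangle$, $G_6=\langle x, a \mid x^{-1} a x=a^2, a^5=1\rangle$, $G_7=\langle x, y \mid x^{-1} y x=y^{-1} x y\rangle$, $G_8=\langle x, a \mid x^{-1} a x=a^2, a^7=1\rangle$, $G_9=\langle x, y \mid x y x y^{-1} x^{-1}=y x^{-1} y x y^{-1},\ x^{-1} y^{-1} x y x=y^{-1} x^{-1} y x y\rangle$. *)

(* Defs.v *)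
From HB Require Import structures.
From mathcomp Require Import all_boot ssralg ssrint zmodp boolp.

Set Implicit Arguments.
Unset Strict Implicit.
Unset Printing Implicit Defensive.

Local Open Scope group_scope.

Definition left_orderable (G : groupType) : Prop :=
  exists lt : G -> G -> Prop,
    [/\ forall g, ~ lt g g,
        forall g1 g2 g3, lt g1 g2 -> lt g2 g3 -> lt g1 g3,
        forall g1 g2, g1 <> g2 -> lt g1 g2 \/ lt g2 g1
      & forall h g1 g2, lt g1 g2 <-> lt (h * g1) (h * g2)].

Definition circularly_orderable (G : groupType) : Prop :=
  exists c : G -> G -> G -> int,
    [/\ forall g1 g2 g3,
          [\/ c g1 g2 g3 = (- 1)%R, c g1 g2 g3 = 0%R | c g1 g2 g3 = 1%R],
        forall g1 g2 g3,
          c g1 g2 g3 = 0%R <-> [\/ g1 = g2, g1 = g3 | g2 = g3],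
        forall g1 g2 g3 g4,
          (c g2 g3 g4 - c g1 g3 g4 + c g1 g2 g4 - c g1 g2 g3 = 0)%R
      & forall h g1 g2 g3, c g1 g2 g3 = c (h * g1) (h * g2) (h * g3)].

Definition isomorphic (G H : groupType) : Prop :=
  exists f : {multiplicative G -> H}, bijective f.

(* Group words in the generators 'I_n, not freely reduced; the letter (i, b)
   is the i-th generator if b is false and its formal inverse if b is true.
   Under concatenation they form a monoid with an anti-involution. *)
Definition word (n : nat) : Type := seq ('I_n * bool).

HB.instance Definition _ n := Choice.on (word n).

Section WordMonoid.
Variable n : nat.
Implicit Types u v w : word n.

Definition word_inv w : word n := rev [seq (l.1, ~~ l.2) | l <- w].

Lemma word_mulA : associative (@cat ('I_n * bool) : word n -> word n -> word n).
Proof. exact: catA. Qed.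

Lemma word_mul1 :
  left_id ([::] : word n) (@cat ('I_n * bool) : word n -> word n -> word n).
Proof. by []. Qed.

Lemma word_invK : involutive word_inv.
Proof.
move=> w; rewrite /word_inv map_rev revK -map_comp -[RHS]map_id.
by apply: eq_map => -[i b] /=; rewrite negbK.
Qed.

Lemma word_invM : {morph word_inv : u v / u ++ v >-> v ++ u}.
Proof. by move=> u v; rewrite /word_inv map_cat rev_cat. Qed.

HB.instance Definition _ :=
  isStarMonoid.Build (word n) word_mulA word_mul1 word_invK word_invM.

Definition gen (i : 'I_n) : word n := [:: (i, false)].

End WordMonoid.

Section Presentation.
Variables (n : nat) (R : seq (word n * word n)).

(* The least congruence on words that makes formal inverses inverses and
   identifies the two sides of every relation in R. *)
Inductive pres_eq : word n -> word n -> Prop :=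
| pres_eq_rel u v of (u, v) \in R : pres_eq u v
| pres_eq_inv u : pres_eq (u * u^-1) 1
| pres_eq_mul u u' v v' of pres_eq u u' & pres_eq v v' :
    pres_eq (u * v) (u' * v')
| pres_eq_refl u : pres_eq u u
| pres_eq_sym u v of pres_eq u v : pres_eq v u
| pres_eq_trans u v w of pres_eq u v & pres_eq v w : pres_eq u w.

Definition pres_eqb : rel (word n) := fun u v => `[< pres_eq u v >].

Lemma pres_eqb_refl : reflexive pres_eqb.
Proof. by move=> u; apply/asboolP/pres_eq_refl. Qed.

Lemma pres_eqb_sym : symmetric pres_eqb.
Proof. by move=> u v; apply/asboolP/asboolP => /pres_eq_sym. Qed.

Lemma pres_eqb_trans : transitive pres_eqb.
Proof.
move=> v u w /asboolP uv /asboolP vw.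
by apply/asboolP; apply: pres_eq_trans uv vw.
Qed.

Canonical pres_equiv := EquivRel pres_eqb pres_eqb_refl pres_eqb_sym pres_eqb_trans.

(* The group with generators 'I_n and relations u = v for (u, v) in R. *)
Definition presented : Type := {eq_quot pres_equiv}%qT.

HB.instance Definition _ := Choice.on presented.

Definition pres_class (w : word n) : presented := (\pi_({eq_quot pres_equiv}) w)%qT.
Definition pres_repr (g : presented) : word n := repr (g : {eq_quot pres_equiv}%qT).

Lemma pres_reprK : cancel pres_repr pres_class.
Proof. exact: reprK. Qed.

Lemma pres_classP u v : pres_class u = pres_class v <-> pres_eq u v.
Proof. by split=> [/eqmodP/asboolP|uv] //; apply/eqmodP/asboolP. Qed.

Lemma pres_repr_class w : pres_eq (pres_repr (pres_class w)) w.
Proof. by apply/pres_classP; rewrite pres_reprK. Qed.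

Definition pres_one : presented := pres_class 1.
Definition pres_inv (g : presented) : presented := pres_class (pres_repr g)^-1.
Definition pres_mul (g h : presented) : presented :=
  pres_class (pres_repr g * pres_repr h).

Lemma pres_classM u v : pres_class (u * v) = pres_mul (pres_class u) (pres_class v).
Proof.
by apply/pres_classP/pres_eq_sym/pres_eq_mul; apply: pres_repr_class.
Qed.

Lemma pres_mulA : associative pres_mul.
Proof.
move=> f g h; rewrite -[f]pres_reprK -[g]pres_reprK -[h]pres_reprK.
by rewrite -!pres_classM mulgA.
Qed.

Lemma pres_mul1g : left_id pres_one pres_mul.
Proof. by move=> g; rewrite -[g]pres_reprK -pres_classM mul1g. Qed.

Lemma pres_mulg1 : right_id pres_one pres_mul.
Proof. by move=> g; rewrite -[g]pres_reprK -pres_classM mulg1. Qed.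

Lemma pres_mulgV : right_inverse pres_one pres_inv pres_mul.
Proof.
move=> g; rewrite -{1}[g]pres_reprK -pres_classM.
exact/pres_classP/pres_eq_inv.
Qed.

Lemma pres_mulVg : left_inverse pres_one pres_inv pres_mul.
Proof.
move=> g; rewrite -{2}[g]pres_reprK -pres_classM -{2}[pres_repr g]invgK.
exact/pres_classP/pres_eq_inv.
Qed.

HB.instance Definition _ :=
  isGroup.Build presented pres_mulA pres_mul1g pres_mulg1 pres_mulVg pres_mulgV.

End Presentation.

(* The additive group of int, written multiplicatively. *)
Definition infinite_cyclic : Type := int.

HB.instance Definition _ := Choice.on infinite_cyclic.
HB.instance Definition _ := isGroup.Build infinite_cyclic
  (@GRing.addrA int) (@GRing.add0r int) (@GRing.addr0 int)
  (@GRing.addNr int) (@GRing.addrN int).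

(* Virtual crossings contribute nothing to the arcs or the Wirtinger relations,
   so a virtual knot diagram is recorded by its oriented signed Gauss code: the
   cyclic sequence of passages through classical crossings met along the knot,
   read from a base point. The passage (c, true) goes over the crossing c and
   (c, false) goes under it. Conversely, every such code comes from a virtual
   knot diagram, in general with virtual crossings. *)
Record gauss_code := GaussCode {
  ncross : nat;
  passages : seq ('I_ncross * bool);
  positive : 'I_ncross -> bool;
  passagesP : forall p : 'I_ncross * bool, count_mem p passages = 1%N
}.

Section KnotGroup.
Variable D : gauss_code.

(* A diagram with n > 0 classical crossings has n arcs, and one without
   classical crossings has a single closed arc: 'I_n.-1.+1 covers both cases.
   Arcs are numbered along the knot, so that the number of the arc reached just
   before the k-th passage is the number of underpassages met so far, modulo n
   (inZp) because the last arc runs through the base point into arc 0. *)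
Definition arc : Type := 'I_(ncross D).-1.+1.

Definition arc_before (k : nat) : arc :=
  inZp (count (fun p => ~~ p.2) (take k (passages D))).

Definition over_arc (c : 'I_(ncross D)) : arc :=
  arc_before (index (c, true) (passages D)).
Definition under_arc_in (c : 'I_(ncross D)) : arc :=
  arc_before (index (c, false) (passages D)).
Definition under_arc_out (c : 'I_(ncross D)) : arc :=
  arc_before (index (c, false) (passages D)).+1.

Definition wirtinger_relation (c : 'I_(ncross D)) :
    word (ncross D).-1.+1 * word (ncross D).-1.+1 :=
  let x := gen (under_arc_in c) in
  let y := gen (under_arc_out c) in
  let z := gen (over_arc c) in
  (y, if positive c then z^-1 * x * z else z * x * z^-1).

Definition knot_group : groupType :=
  presented [seq wirtinger_relation c | c <- enum 'I_(ncross D)].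

End KnotGroup.

(* Green's table lists the virtual knots that have a diagram with at most four
   classical crossings, one from each class under reversal and mirror images.
   All members of these classes are included here. *)
Definition green_table_group (G : groupType) : Prop :=
  exists D : gauss_code, (ncross D <= 4)%N /\ isomorphic G (knot_group D).

Section Groups.
Let x : word 2 := gen (inord 0).
Let y : word 2 := gen (inord 1).
Let a : word 2 := gen (inord 1).

Definition G1 : groupType := presented [:: (x * y * x, y * x * y)].

Definition G2 : groupType := presented [:: (x^-1 * a * x, a^-1); (a ^+ 3, 1)].

Definition G3 : groupType :=
  presented [:: (x * y * x, y * x * y); (y, x ^- 3 * y * x ^+ 3)].

Definition G4 : groupType :=
  presented [:: (x^-1 * y * x * y^-1 * x, y * x^-1 * y * x * y^-1)].

Definition G5 : groupType := presented [:: (x^-1 * a * x, a^-1); (a ^+ 5, 1)].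

Definition G6 : groupType := presented [:: (x^-1 * a * x, a ^+ 2); (a ^+ 5, 1)].

Definition G7 : groupType := presented [:: (x^-1 * y * x, y^-1 * x * y)].

Definition G8 : groupType := presented [:: (x^-1 * a * x, a ^+ 2); (a ^+ 7, 1)].

Definition G9 : groupType :=
  presented [:: (x * y * x * y^-1 * x^-1, y * x^-1 * y * x * y^-1);
                (x^-1 * y^-1 * x * y * x, y^-1 * x^-1 * y * x * y)].

End Groups.

(* Main.v *)
From HB Require Import structures.
Require Import Defs.
From mathcomp Require Import all_boot order ssralg ssrnum ssrint rat boolp.
From mathcomp Require Import zify ring.
From Stdlib Require Ascii String.

Set Implicit Arguments.
Unset Strict Implicit.
Unset Printing Implicit Defensive.

Import Order.TTheory GRing.Theory Num.Theory.
Import String.StringSyntax.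

Local Open Scope string_scope.
Local Open Scope group_scope.

(** The proof identifies the group of every diagram with at most four classical
    crossings, and then decides orderability for the ten groups that occur.

    Identification. The Wirtinger presentation only depends on the over-arc and
    the sign met at each underpassage, listed along the knot (a code, see
    knot_code_presents); there are 1, 2, 16, 216 and 4096 codes with 0, ..., 4
    crossings. A crossing passed under one of its own under-arcs identifies these
    two arcs and can be removed (collapse_presents), and moving the base point,
    reversing the knot or inverting all meridians does not change the group.
    Up to these moves 27 codes remain. For each of them a table gives a change
    of generators to one of the ten presentations, together with a derivation of
    every relator of one side from those of the other as a product of conjugates;
    such a product is checked by free reduction (certified_presents).

    Groups that are not circularly orderable. Let c be a left-invariant circular
    order and A a finite subgroup. The sum over t in A of c(1, t, t g) is, modulo
    #|A|, additive in g by the cocycle identity: it is a rotation number of g. It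
    is invariant under conjugation by the normalizer of A, up to an even multiple
    of #|A|, and it is small, whence an element that normalizes A centralizes A
    (finite_normalized_centralized). In G2, G5, G6, G8 the generator x
    normalizes, without centralizing it, the finite subgroup generated by a; in
    G3 the element y x^-1 has order 4, and is inverted by x y x. Finite quotients
    show that the two elements do not commute. A left order gives a circular
    order, so none of these groups is left-orderable either.

    Left-orderable groups. In G1, G4, G7, G9 put a = y x^-1 and write a_i for
    x^i a x^-i. The relators become
      G1: a_2 = a_0^-1 a_1,             G4: a_2 = a_1 a_0^-1 a_1^2,
      G7: a_1 = a_0^2,                  G9: a_0 a_1 = a_1 a_0, a_2 = a_1^2 a_0^-2.
    Hence G1 and G4 are the mapping tori of automorphisms of a free group of rank
    two (trefoil and figure-eight knots), G7 is the Baumslag-Solitar group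
    BS(1, 2), and G9 is an ascending extension of Z^2. In all cases the kernel of
    the abelianization embeds in a left-orderable group H on which x acts by an
    automorphism: a free group or the additive group of Q^2. An extension of a
    left-orderable group by the integers is left-orderable (hnn_left_orderable),
    and free groups are by an explicit order on the Cayley tree, due to Dicks and
    Sunic (free_group_left_orderable). *)

(** * Words and presentations *)

Section GroupMorphism.
Variables (G H : groupType) (f : {multiplicative G -> H}).

Lemma gmulf1_group : f 1 = 1.
Proof. by apply/(mulgI (f 1)); rewrite -gmulfM !mulg1. Qed.

Lemma gmulfV_group g : f g^-1 = (f g)^-1.
Proof. by apply/(mulgI (f g)); rewrite -gmulfM !mulgV gmulf1_group. Qed.

End GroupMorphism.

Section Words.
Variable I : eqType.
Implicit Types (l : I * bool) (u v w : seq (I * bool)).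

Definition flip l := (l.1, ~~ l.2).
Definition formal_inv w := rev (map flip w).

Lemma flipK : involutive flip.
Proof. by case=> i b; rewrite /flip negbK. Qed.

(** Multiplication of a reduced word by a letter on the left. *)
Definition push l w :=
  if w is l' :: w' then if l' == flip l then w' else l :: w else [:: l].

Definition free_red w := foldr push [::] w.

Section Evaluation.
Variables (H : groupType) (x : I -> H).

Definition ev_letter l : H := if l.2 then (x l.1)^-1 else x l.1.
Definition ev w : H := foldr (fun l h => ev_letter l * h) 1 w.

Lemma ev_cat u v : ev (u ++ v) = ev u * ev v.
Proof. by elim: u => [|l u IHu] /=; rewrite ?mul1g // IHu mulgA. Qed.

Lemma ev_flip l : ev_letter (flip l) = (ev_letter l)^-1.
Proof. by case: l => i [] /=; rewrite /ev_letter ?invgK. Qed.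

Lemma ev_formal_inv w : ev (formal_inv w) = (ev w)^-1.
Proof.
rewrite /formal_inv; elim: w => [|l w IHw] /=; first by rewrite invg1.
by rewrite rev_cons -cats1 ev_cat IHw /= ev_flip mulg1 invgM.
Qed.

Lemma ev_push l w : ev (push l w) = ev_letter l * ev w.
Proof.
by case: w => //= l' w; case: eqP => // ->; rewrite ev_flip mulVKg.
Qed.

Lemma ev_free_red w : ev (free_red w) = ev w.
Proof. by elim: w => //= l w IHw; rewrite ev_push IHw. Qed.

End Evaluation.

Lemma ev_gmulf (H K : groupType) (f : {multiplicative H -> K}) x w :
  f (ev x w) = ev (f \o x) w.
Proof.
elim: w => [|[i b] w IHw]; first exact: gmulf1_group.
by rewrite /= gmulfM IHw /ev_letter; case: b => //=; rewrite gmulfV_group.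
Qed.

Lemma eq_ev (H : groupType) (x y : I -> H) w : x =1 y -> ev x w = ev y w.
Proof. by move=> xy; elim: w => //= l w ->; rewrite /ev_letter xy. Qed.

End Words.

Lemma ev_map (I J : eqType) (H : groupType) (f : I -> J) (x : J -> H) w :
  ev x [seq (f l.1, l.2) | l <- w] = ev (x \o f) w.
Proof. by elim: w => //= l w ->. Qed.

(** Presentations are handled with generators numbered by all natural numbers,
    those beyond the first n being trivial: words then live in one type for all
    presentations, and computation on them meets no ordinals. *)
Definition nword := seq (nat * bool).

Definition subst (alpha : seq nword) (w : nword) : nword :=
  flatten [seq (if l.2 then formal_inv (nth [::] alpha l.1)
                else nth [::] alpha l.1) | l <- w].

Lemma ev_subst (H : groupType) (x : nat -> H) alpha w :
  ev x (subst alpha w) = ev (fun i => ev x (nth [::] alpha i)) w.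
Proof.
elim: w => //= -[i b] w <-; rewrite /subst /= ev_cat /ev_letter /=.
by case: b => //=; rewrite ev_formal_inv.
Qed.

Definition model n (R : seq nword) (H : groupType) (x : nat -> H) : Prop :=
  (forall i, n <= i -> x i = 1) /\ (forall r, r \in R -> ev x r = 1).

(** Only the existence of suitable generators is recorded: a change of
    presentation then concerns one fixed group, and groups are compared only at
    the very end, by presents_isomorphic. *)
Definition presents (G : groupType) n (R : seq nword) : Prop :=
  exists t : nat -> G,
    [/\ model n R t, forall g, exists w, g = ev t w
      & forall (H : groupType) (x : nat -> H), model n R x ->
          exists f : {multiplicative G -> H}, forall i, f (t i) = x i].

Definition multiplicative_of (G H : groupType) (f : G -> H)
    (fM : {morph f : g h / g * h}) : {multiplicative G -> H} :=
  HB.pack f (isMultiplicative.Build G H f fM).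

Lemma isomorphic_sym G H : isomorphic G H -> isomorphic H G.
Proof.
move=> [f [f' fK f'K]]; exists (multiplicative_of (can2_gmulfM fK f'K)).
by exists f.
Qed.

Lemma isomorphic_trans G H K :
  isomorphic G H -> isomorphic H K -> isomorphic G K.
Proof. by move=> [f bij_f] [g bij_g]; exists (g \o f); apply: bij_comp. Qed.

(** The universal property of each group yields a morphism to the other; the
    composites fix the generators. *)
Lemma presents_isomorphic G H n R :
  presents G n R -> presents H n R -> isomorphic G H.
Proof.
move=> [t [t_mod t_gen t_univ]] [s [s_mod s_gen s_univ]].
have [f ft] := t_univ H s s_mod; have [g gs] := s_univ G t t_mod.
exists f, g => [u|v].
  have [w ->] := t_gen u; rewrite !ev_gmulf; apply: eq_ev => i /=.
  by rewrite ft gs.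
have [w ->] := s_gen v; rewrite !ev_gmulf; apply: eq_ev => i /=.
by rewrite gs ft.
Qed.

(** Tietze transformations, read in all groups at once: alpha writes the new
    generators in the old ones, beta the old ones in the new, and the solutions of
    the two systems of relators in any group correspond to each other. *)
Lemma presents_change G n R n' R' (alpha beta : seq nword) :
    (forall (H : groupType) (x : nat -> H), model n R x ->
       let y i := ev x (nth [::] alpha i) in
       model n' R' y /\ forall i, ev y (nth [::] beta i) = x i) ->
    (forall (H : groupType) (y : nat -> H), model n' R' y ->
       let x i := ev y (nth [::] beta i) in
       model n R x /\ forall i, ev x (nth [::] alpha i) = y i) ->
  presents G n R -> presents G n' R'.
Proof.
move=> fwd bwd [t [t_mod t_gen t_univ]].
have [s_mod st] := fwd G t t_mod.
exists (fun i => ev t (nth [::] alpha i)); split=> // [g|H y y_mod].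
  have [w ->] := t_gen g; exists (subst beta w).
  by rewrite ev_subst; apply: eq_ev => i; rewrite st.
have [x_mod xy] := bwd H y y_mod; have [f fx] := t_univ H _ x_mod.
by exists f => i; rewrite ev_gmulf -xy; apply: eq_ev.
Qed.

Lemma presents_eq G n R R' :
    (forall (H : groupType) (x : nat -> H), model n R x <-> model n R' x) ->
  presents G n R -> presents G n R'.
Proof.
move=> RR' [t [t_mod t_gen t_univ]]; exists t; split=> //; first exact/RR'.
by move=> H x x_mod; apply/t_univ/RR'.
Qed.

Definition forget n (w : word n) : nword := [seq (val l.1, l.2) | l <- w].

Definition relator n (r : word n * word n) : nword :=
  forget r.1 ++ formal_inv (forget r.2).

Lemma ev_relator (H : groupType) n (x : nat -> H) (r : word n * word n) :
  ev x (relator r) = 1 <-> ev (x \o val) r.1 = ev (x \o val) r.2.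
Proof.
rewrite ev_cat ev_formal_inv !ev_map; split; first exact: divg1_eq.
by move=> ->; rewrite mulgV.
Qed.

Section Presented.
Variables (n : nat) (R : seq (word n * word n)).

Lemma ev_pres_eq (H : groupType) (x : 'I_n -> H) :
    (forall r, r \in R -> ev x r.1 = ev x r.2) ->
  forall u v, pres_eq R u v -> ev x u = ev x v.
Proof.
move=> xR u v; elim=> {u v} //.
- by move=> u v /xR.
- by move=> u; rewrite ev_cat ev_formal_inv mulgV.
- by move=> u u' v v' _ uu' _ vv'; rewrite !ev_cat uu' vv'.
- by move=> u v w _ -> _ ->.
Qed.

Lemma pres_class_ev (w : word n) :
  pres_class R w = ev (fun i => pres_class R (gen i)) w.
Proof.
have pM u v : pres_class R (u * v) = pres_class R u * pres_class R v.
  exact: pres_classM.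
elim: w => [|[i b] w IHw] //=; rewrite -IHw.
have -> : pres_class R ((i, b) :: w) = pres_class R [:: (i, b)] * pres_class R w.
  by rewrite -pM.
congr (_ * _); rewrite /ev_letter /=; case: b => //.
apply/(mulgI (pres_class R (gen i))); rewrite mulgV -pM.
exact/pres_classP/pres_eq_inv.
Qed.

Lemma presented_presents : presents (presented R) n (map (@relator n) R).
Proof.
pose t i : presented R := if insub i is Some j then pres_class R (gen j) else 1.
have tE : t \o val =1 (fun j : 'I_n => pres_class R (gen j)).
  by move=> j; rewrite /t /= valK.
exists t; split.
- split=> [i le_ni|_ /mapP[r Rr ->]]; first by rewrite /t insubF // ltnNge le_ni.
  apply/ev_relator; rewrite !(eq_ev _ tE) -!pres_class_ev.
  by apply/pres_classP/pres_eq_rel; rewrite -surjective_pairing.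
- move=> g; exists (forget (pres_repr g)).
  by rewrite ev_map (eq_ev _ tE) -pres_class_ev pres_reprK.
- move=> H x [x0 xR].
  have {}xR r : r \in R -> ev (x \o val) r.1 = ev (x \o val) r.2.
    by move=> Rr; apply/ev_relator/xR/map_f.
  have xE := ev_pres_eq xR.
  pose f (g : presented R) := ev (x \o val) (pres_repr g).
  have fM : {morph f : g h / g * h}.
    by move=> g h; rewrite /f -ev_cat; apply/xE/pres_repr_class.
  exists (multiplicative_of fM) => i /=; rewrite /t.
  case: insubP => [j _ <-|]; last first.
    by rewrite -leqNgt => /x0->; apply: (xE _ [::]); apply: pres_repr_class.
  rewrite -[RHS](mulg1 (x (val j))); apply: (xE _ (gen j)).
  exact: pres_repr_class.
Qed.

End Presented.

(** A word is a consequence of relators when it is freely equal to a product of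
    conjugates of relators and of their inverses. The factor (g, i, b) stands for
    the conjugate by g of the i-th relator, inverted if b is true. *)
Definition derivation := seq (nword * nat * bool).

Definition derived (R : seq nword) (d : derivation) : nword :=
  flatten [seq let r := nth [::] R c.1.2 in
               c.1.1 ++ (if c.2 then formal_inv r else r) ++ formal_inv c.1.1
          | c <- d].

Definition derives R d w := free_red w == free_red (derived R d).

Lemma ev_derives n R (H : groupType) (x : nat -> H) d w :
  model n R x -> derives R d w -> ev x w = 1.
Proof.
move=> [_ xR] /eqP dw; rewrite -ev_free_red dw ev_free_red.
have ev_rel i : ev x (nth [::] R i) = 1.
  have [ltiR|leRi] := ltnP i (size R); first exact/xR/mem_nth.
  by rewrite nth_default.
rewrite /derived; elim: d {dw} => [|[[g i] b] d IHd] //=.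
rewrite !ev_cat IHd mulg1 ev_formal_inv.
have -> : ev x (if b then formal_inv (nth [::] R i) else nth [::] R i) = 1.
  by case: b; rewrite ?ev_formal_inv ev_rel ?invg1.
by rewrite mul1g mulgV.
Qed.

Definition derive_all R (ds : seq derivation) (ws : seq nword) :=
  (size ds == size ws) && all (fun p => derives R p.1 p.2) (zip ds ws).

Lemma ev_derive_all n R (H : groupType) (x : nat -> H) ds ws :
  model n R x -> derive_all R ds ws -> forall w, w \in ws -> ev x w = 1.
Proof.
move=> xR /andP[/eqP sz_ds /allP ds_ok] w ws_w.
have lt_w : index w ws < size ws by rewrite index_mem.
apply: (ev_derives (d := nth [::] ds (index w ws)) xR).
have := ds_ok (nth ([::], [::]) (zip ds ws) (index w ws)).
rewrite nth_zip // nth_index //=; apply.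
by rewrite -[w in X in (_, X)](nth_index [::] ws_w) -nth_zip // mem_nth //
           size_zip sz_ds minnn.
Qed.

Definition letter_word i : nword := [:: (i, false)].

(** The data of presents_change. The last two fields derive that the two
    substitutions are inverse to each other, the first from the old relators and
    the second from the new ones. *)
Record certificate := Certificate {
  new_gens : seq nword;
  old_gens : seq nword;
  new_derivations : seq derivation;
  old_derivations : seq derivation;
  back_derivations : seq derivation;
  forth_derivations : seq derivation
}.

Definition certified n R n' R' (C : certificate) :=
  let alpha := new_gens C in
  let beta := old_gens C in
  [&& size alpha == n', size beta == n,
      derive_all R (new_derivations C) (map (subst alpha) R'),
      derive_all R' (old_derivations C) (map (subst beta) R),
      derive_all R (back_derivations C)
        [seq subst alpha (nth [::] beta i) ++ formal_inv (letter_word i)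
        | i <- iota 0 n]
    & derive_all R' (forth_derivations C)
        [seq subst beta (nth [::] alpha j) ++ formal_inv (letter_word j)
        | j <- iota 0 n']].

Lemma certified_presents G n R n' R' C :
  certified n R n' R' C -> presents G n R -> presents G n' R'.
Proof.
case: C => alpha beta d1 d2 d3 d4 /and5P[/= /eqP sz_a /eqP sz_b d1P d2P /andP[d3P d4P]].
have back (H : groupType) (x : nat -> H) m S ds (ws us : seq nword) j :
    model m S x ->
    derive_all S ds [seq subst ws (nth [::] us i) ++ formal_inv (letter_word i)
                    | i <- iota 0 (size us)] ->
    j < size us -> ev x (subst ws (nth [::] us j)) = x j.
  move=> xS dsP lt_j; apply: divg1_eq; have := ev_derive_all xS dsP.
  move=> /(_ (subst ws (nth [::] us j) ++ formal_inv (letter_word j))).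
  rewrite ev_cat ev_formal_inv /= /ev_letter mulg1; apply.
  by apply: (map_f (fun i => _)); rewrite mem_iota.
subst n n'.
apply: (presents_change (alpha := alpha) (beta := beta)) => H x x_mod /=.
- split; first split=> [i le_ni|r R'r].
  + by rewrite nth_default.
  + by rewrite -ev_subst (ev_derive_all x_mod d1P) ?map_f.
  + move=> i; have [ltin|leni] := ltnP i (size beta); last first.
      by rewrite nth_default //= x_mod.1.
    by rewrite -ev_subst; apply: back x_mod d3P _.
- split; first split=> [i le_ni|r Rr].
  + by rewrite nth_default.
  + by rewrite -ev_subst (ev_derive_all x_mod d2P) ?map_f.
  + move=> j; have [ltjn|lenj] := ltnP j (size alpha); last first.
      by rewrite nth_default //= x_mod.1.
    by rewrite -ev_subst; apply: back x_mod d4P _.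
Qed.

(** * Knot groups and codes of diagrams *)

(** The over-arc and the sign met at each underpassage, in the order of the knot.
    The under-arcs need not be recorded: the i-th crossing leads from arc i to
    arc i + 1, modulo the number of crossings. *)
Definition code := seq (nat * bool).

Definition code_relator (s : code) i : nword :=
  let c := nth (0, false) s i in
  [:: c; (i, false); flip c; (i.+1 %% size s, true)].

Definition code_relators (s : code) := map (code_relator s) (iota 0 (size s)).

Definition code_presents (G : groupType) (s : code) :=
  presents G (size s).-1.+1 (code_relators s).

Definition conj_by (H : groupType) (b : bool) (z x : H) :=
  if b then z^-1 * x * z else z * x * z^-1.

(** The Wirtinger relations as equations: arcs are colored by elements of H. *)
Definition colors (H : groupType) (s : code) (x : nat -> H) :=
  forall i, i < size s ->
  x (i.+1 %% size s) =
    conj_by (nth (0, false) s i).2 (x (nth (0, false) s i).1) (x i).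

Lemma model_code (H : groupType) s (x : nat -> H) :
  model (size s).-1.+1 (code_relators s) x <->
  (forall i, (size s).-1.+1 <= i -> x i = 1) /\ colors s x.
Proof.
have evE i : ev x (code_relator s i) =
    conj_by (nth (0, false) s i).2 (x (nth (0, false) s i).1) (x i) /
    x (i.+1 %% size s).
  rewrite /code_relator /=; case: nth => z [] /=;
  by rewrite /ev_letter /conj_by /= mulg1 !mulgA.
split=> -[x0 xs]; split=> //.
  move=> i lt_is; apply/esym/divg1_eq; rewrite -evE; apply: xs.
  by apply: map_f; rewrite mem_iota.
move=> _ /mapP[i + ->]; rewrite mem_iota => /andP[_ lt_is].
by rewrite evE -xs // mulgV.
Qed.

Section KnotCode.
Variable D : gauss_code.
Let n := ncross D.

Definition underpassages : seq 'I_n := [seq p.1 | p <- passages D & ~~ p.2].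

Definition knot_code : code :=
  [seq (val (over_arc c), positive c) | c <- underpassages].

Lemma mem_passages p : p \in passages D.
Proof. by rewrite -has_pred1 has_count passagesP. Qed.

Lemma uniq_passages : uniq (passages D).
Proof. by apply: count_mem_uniq => p; rewrite passagesP mem_passages. Qed.

Lemma mem_underpassages c : c \in underpassages.
Proof. by apply/mapP; exists (c, false) => //; rewrite mem_filter mem_passages. Qed.

Lemma uniq_underpassages : uniq underpassages.
Proof.
rewrite map_inj_in_uniq ?filter_uniq ?uniq_passages //.
move=> [c b] [c' b'] /=; rewrite !mem_filter /= => /andP[+ _] /andP[+ _].
by case: b b' => [] [] //= _ _ ->.
Qed.

Lemma size_underpassages : size underpassages = n.
Proof.
rewrite -[RHS]card_ord cardE; apply/perm_size/uniq_perm.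
- exact: uniq_underpassages.
- exact: enum_uniq.
- by move=> c; rewrite mem_enum mem_underpassages.
Qed.

Lemma index_underpassages (c : 'I_n) : index c underpassages < n.
Proof.
by apply: leq_trans (eq_leq size_underpassages); rewrite index_mem mem_underpassages.
Qed.

(** The arc that arrives at a crossing from below is numbered by the rank of the
    crossing among the underpassages, so that arcs and crossings share the same
    numbers. *)
Lemma count_before_under (c : 'I_n) :
  count (fun p => ~~ p.2) (take (index (c, false) (passages D)) (passages D)) =
  index c underpassages.
Proof.
rewrite /underpassages; elim: (passages D) (mem_passages (c, false)) => //=.
move=> [c' b] s IHs; rewrite inE xpair_eqE.
have [<- /=|ne_cc' /=] := eqVneq c c'; case: b => /=; rewrite ?eqxx /= => s_c.
- by rewrite xpair_eqE eqxx /= add0n IHs.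
- by [].
- by rewrite xpair_eqE eq_sym (negbTE ne_cc') /= add0n IHs.
- by rewrite xpair_eqE eq_sym (negbTE ne_cc') /= add1n IHs.
Qed.

Lemma under_arc_inE (c : 'I_n) : val (under_arc_in c) = index c underpassages.
Proof.
have lt_cn := index_underpassages c.
rewrite /under_arc_in /arc_before count_before_under /=.
by rewrite prednK ?modn_small // (leq_ltn_trans _ lt_cn).
Qed.

Lemma under_arc_outE (c : 'I_n) :
  val (under_arc_out c) = (index c underpassages).+1 %% n.
Proof.
have n_gt0 : 0 < n by apply: leq_ltn_trans (index_underpassages c).
rewrite /under_arc_out /arc_before (take_nth (c, false)); last first.
  by rewrite index_mem mem_passages.
rewrite -cats1 count_cat count_before_under nth_index ?mem_passages //=.
by rewrite addn0 addn1 prednK.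
Qed.

Lemma size_knot_code : size knot_code = n.
Proof. by rewrite size_map size_underpassages. Qed.

Lemma knot_code_presents : code_presents (knot_group D) knot_code.
Proof.
rewrite /code_presents size_knot_code.
apply: presents_eq (presented_presents _) => H x.
have over_nth (c : 'I_n) :
    nth (0, false) knot_code (index c underpassages) =
    (val (over_arc c), positive c).
  by rewrite (nth_map c) ?index_mem ?mem_underpassages // nth_index //
             mem_underpassages.
have relE c : ev x (relator (wirtinger_relation c)) = 1 <->
    x ((index c underpassages).+1 %% n) =
    conj_by (positive c) (x (val (over_arc c))) (x (index c underpassages)).
  rewrite -under_arc_outE -under_arc_inE; apply: (iff_trans (ev_relator _ _)).
  rewrite /= /conj_by; case: (positive c) => /=;
  by rewrite /ev_letter /= !mulg1 !mulgA.
have := model_code knot_code x; rewrite size_knot_code => codeE.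
apply: iff_trans (iff_sym codeE); split=> -[x0 xR]; split=> //.
- move=> i; rewrite size_knot_code => ltin.
  have -> : i = index (nth (Ordinal ltin) underpassages i) underpassages.
    by rewrite index_uniq ?uniq_underpassages ?size_underpassages.
  by rewrite over_nth; apply/relE/xR/map_f/map_f; rewrite mem_enum.
- move=> _ /mapP[_ /mapP[c _ ->] ->]; apply/relE.
  have := xR (index c underpassages); rewrite over_nth size_knot_code.
  by apply; apply: index_underpassages.
Qed.

Lemma knot_code_valid : all (fun c => c.1 < size knot_code) knot_code.
Proof.
apply/allP => _ /mapP[c _ ->] /=; rewrite size_knot_code.
have n_gt0 : 0 < n by apply: leq_ltn_trans (index_underpassages c).
by apply: leq_trans (ltn_ord (over_arc c)) _; rewrite prednK.
Qed.

End KnotCode.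

(** * Moves between codes *)

Definition valid_code (s : code) := all (fun c => c.1 < size s) s.

Lemma valid_code_nth s i : valid_code s -> i < size s ->
  (nth (0, false) s i).1 < size s.
Proof. by move=> /allP s_ok lt_is; apply/s_ok/mem_nth. Qed.

(** The three invertible moves below renumber the arcs by a permutation sigma or
    replace every arc by its inverse (b = true); for these it is enough to compare
    colorings. *)
Lemma code_presents_renumber G s s' (sigma tau : nat -> nat) (b : bool) :
    size s' = size s ->
    (forall i, i < size s -> sigma i < size s /\ tau (sigma i) = i) ->
    (forall i, i < size s -> tau i < size s /\ sigma (tau i) = i) ->
    (forall (H : groupType) (x y : nat -> H),
       (forall i, i < size s -> y i = ev_letter x (sigma i, b)) ->
       colors s x <-> colors s' y) ->
  code_presents G s -> code_presents G s'.
Proof.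
move=> sz_s' sigmaK tauK eq_colors; rewrite /code_presents sz_s'.
have [s0|s_gt0] := posnP (size s).
  by rewrite (size0nil (etrans sz_s' s0)) (size0nil s0).
set n := size s in sigmaK tauK eq_colors s_gt0 *; rewrite prednK //.
have modelE (H : groupType) c (x : nat -> H) : size c = n ->
    model n (code_relators c) x <->
    (forall i, n <= i -> x i = 1) /\ colors c x.
  by move=> sz_c; have := model_code c x; rewrite sz_c prednK.
pose relabel (f : nat -> nat) : seq nword :=
  [seq [:: (f i, b)] | i <- iota 0 n].
have relabelE f (H : groupType) (x : nat -> H) i :
    ev x (nth [::] (relabel f) i) = if i < n then ev_letter x (f i, b) else 1.
  have [lt_in|le_ni] := ltnP i n; last by rewrite nth_default ?size_map ?size_iota.
  by rewrite (nth_map 0) ?size_iota // nth_iota //= mulg1.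
have letterK (H : groupType) (x y : nat -> H) i j :
    y i = ev_letter x (j, b) -> ev_letter y (i, b) = x j.
  by rewrite /ev_letter /=; case: (b) => // ->; rewrite invgK.
apply: (presents_change (alpha := relabel sigma) (beta := relabel tau)).
- move=> H x /modelE[//|x0 xs] y.
  have yE i : i < n -> y i = ev_letter x (sigma i, b).
    by move=> lt_in; rewrite /y relabelE lt_in.
  split=> [|i].
    apply/modelE => //; split; last exact/(eq_colors _ x).
    by move=> i le_ni; rewrite /y relabelE ltnNge le_ni.
  rewrite relabelE; have [lt_in|/x0 -> //] := ltnP i n.
  have [lt_ti sti] := tauK i lt_in.
  by rewrite -[in RHS]sti; apply: letterK; rewrite yE.
- move=> H y /modelE[//|y0 ys] x.
  have xE i : i < n -> x i = ev_letter y (tau i, b).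
    by move=> lt_in; rewrite /x relabelE lt_in.
  have yE i : i < n -> y i = ev_letter x (sigma i, b).
    move=> lt_in; have [lt_si tsi] := sigmaK i lt_in.
    by apply/esym/letterK; rewrite xE // tsi.
  split=> [|i].
    apply/modelE => //; split; last exact/(eq_colors _ x y yE).
    by move=> i le_ni; rewrite /x relabelE ltnNge le_ni.
  by rewrite relabelE; have [/yE|/y0] := ltnP i n.
Qed.

Definition mirror (s : code) : code := [seq flip c | c <- s].

Definition rotate (s : code) : code :=
  [seq ((c.1 + (size s).-1) %% size s, c.2) | c <- rot 1 s].

Definition reverse (s : code) : code :=
  [seq ((size s - c.1) %% size s, ~~ c.2) | c <- rev s].

Lemma size_mirror s : size (mirror s) = size s.
Proof. exact: size_map. Qed.

Lemma size_rotate s : size (rotate s) = size s.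
Proof. by rewrite size_map size_rot. Qed.

Lemma size_reverse s : size (reverse s) = size s.
Proof. by rewrite size_map size_rev. Qed.

Lemma valid_mirror s : valid_code s -> valid_code (mirror s).
Proof.
move=> /allP s_ok; apply/allP => _ /mapP[c s_c ->].
by rewrite size_mirror; apply: (s_ok c).
Qed.

Lemma valid_rotate s : valid_code (rotate s).
Proof.
case: s => // c0 s; apply/allP => _ /mapP[c _ ->].
by rewrite size_rotate; apply: ltn_pmod.
Qed.

Lemma valid_reverse s : valid_code (reverse s).
Proof.
case: s => // c0 s; apply/allP => _ /mapP[c _ ->].
by rewrite size_reverse; apply: ltn_pmod.
Qed.

Lemma conj_byV (H : groupType) b (z x y : H) :
  (y = conj_by b z x) <-> (x = conj_by (~~ b) z y).
Proof.
by rewrite /conj_by; case: b; split=> -> /=;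
  rewrite !mulgA ?mulgV ?mulVg ?mul1g ?mulgVK ?mulgK.
Qed.

(** Inverting every arc turns conjugation by an arc into conjugation by its
    inverse. *)
Lemma mirror_presents G s :
  valid_code s -> code_presents G s -> code_presents G (mirror s).
Proof.
move=> s_ok; apply: (code_presents_renumber (sigma := id) (tau := id) (b := true)).
- exact: size_mirror.
- by [].
- by [].
move=> H x y yE; rewrite /colors size_mirror.
apply: (@iff_trans _ (forall i, i < size s ->
  (y (i.+1 %% size s) = conj_by (~~ (nth (0, false) s i).2)
     (y (nth (0, false) s i).1) (y i)))); last first.
  by split=> ys i lt_is; have := ys i lt_is; rewrite (nth_map (0, false)).
have lt_next i : i < size s -> i.+1 %% size s < size s.
  by move=> lt_is; rewrite ltn_pmod ?(leq_ltn_trans _ lt_is).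
split=> xs i lt_is; have := xs i lt_is;
  rewrite !yE ?lt_next ?valid_code_nth // /ev_letter /=.
  by move=> ->; rewrite /conj_by; case: (_.2); rewrite /= !invgM ?invgK !mulgA.
move=> /(congr1 inv); rewrite invgK => ->.
by rewrite /conj_by; case: (_.2); rewrite /= !invgM ?invgK !mulgA.
Qed.

(** The base point moves past the first underpassage, so that all numbers drop
    by one. *)
Lemma rotate_presents G s :
  valid_code s -> code_presents G s -> code_presents G (rotate s).
Proof.
move=> s_ok; set n := size s.
have n_pos i : i < n -> 0 < n by apply: leq_ltn_trans.
have predK i : i < n -> (i.+1 %% n + n.-1) %% n = i.
  move=> lt_in; rewrite modnDml addSn -addnS prednK ?(n_pos i) //.
  by rewrite modnDr modn_small.
have succK i : i < n -> ((i + n.-1) %% n).+1 %% n = i.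
  move=> lt_in; rewrite -addn1 modnDml addn1 -addnS prednK ?(n_pos i) //.
  by rewrite modnDr modn_small.
have ltS i j : i < n -> j %% n < n by move=> /n_pos n_gt0; rewrite ltn_pmod.
have nth_rotate i : i < n -> nth (0, false) (rotate s) i =
    let c := nth (0, false) s (i.+1 %% n) in ((c.1 + n.-1) %% n, c.2).
  move=> lt_in; rewrite (nth_map (0, false)) ?size_rot //.
  suff -> : nth (0, false) (rot 1 s) i = nth (0, false) s (i.+1 %% n) by [].
  rewrite /n in lt_in *; case: (s) lt_in => // c s' lt_in.
  rewrite rot1_cons nth_rcons; have [lt_is'|] := ltnP i (size s').
    by rewrite modn_small.
  rewrite leq_eqVlt ltnNge -ltnS lt_in orbF => /eqP <-.
  by rewrite eqxx modnn.
apply: (code_presents_renumber (sigma := fun i => i.+1 %% n)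
          (tau := fun i => (i + n.-1) %% n) (b := false)).
- exact: size_rotate.
- by move=> i lt_in; rewrite predK // (ltS i).
- by move=> i lt_in; rewrite succK // (ltS i).
move=> H x y yE; rewrite /colors size_rotate -/n.
have {}yE i : i < n -> y i = x (i.+1 %% n) by move=> /yE.
have stepE i : i < n ->
    (y (i.+1 %% n) = conj_by (nth (0, false) (rotate s) i).2
       (y (nth (0, false) (rotate s) i).1) (y i)) <->
    (x ((i.+1 %% n).+1 %% n) = conj_by (nth (0, false) s (i.+1 %% n)).2
       (x (nth (0, false) s (i.+1 %% n)).1) (x (i.+1 %% n))).
  move=> lt_in; rewrite nth_rotate //= !yE ?(ltS i) // succK //.
  by apply: valid_code_nth; rewrite ?(ltS i).
split=> [xs i lt_in|ys i lt_in]; first by apply/stepE => //; apply/xs/(ltS i).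
have := ys ((i + n.-1) %% n) (ltS _ _ lt_in).
by rewrite stepE ?(ltS i) // succK.
Qed.

(** Traversing the knot backwards exchanges the two under-arcs of a crossing. *)
Lemma reverse_presents G s :
  valid_code s -> code_presents G s -> code_presents G (reverse s).
Proof.
move=> s_ok; set n := size s; pose sigma i := (n - i) %% n.
have lt_sigma i j : i < n -> sigma j < n.
  by move=> lt_in; rewrite ltn_pmod // (leq_ltn_trans _ lt_in).
have sigmaK i : i < n -> sigma (sigma i) = i.
  move=> lt_in; rewrite /sigma; case: i lt_in => [|i] lt_in.
    by rewrite subn0 modnn subn0 modnn.
  rewrite [in n - (_ %% _)]modn_small; last by lia.
  by rewrite subKn ?modn_small // ltnW.
have sigmaS i : i < n -> sigma (i.+1 %% n) = n.-1 - i.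
  move=> lt_in; rewrite /sigma; have [->|ne_in] := eqVneq i n.-1.
    by rewrite prednK ?(leq_ltn_trans _ lt_in) // modnn subn0 modnn subnn.
  by rewrite [_.+1 %% n]modn_small ?modn_small; lia.
have nth_reverse i : i < n -> nth (0, false) (reverse s) i =
    let c := nth (0, false) s (n.-1 - i) in (sigma c.1, ~~ c.2).
  move=> lt_in; rewrite (nth_map (0, false)) ?size_rev //.
  by rewrite nth_rev // subnS -/n -subn1 subnAC subn1.
apply: (code_presents_renumber (sigma := sigma) (tau := sigma) (b := false)).
- exact: size_reverse.
- by move=> i lt_in; rewrite sigmaK // (lt_sigma i).
- by move=> i lt_in; rewrite sigmaK // (lt_sigma i).
move=> H x y yE; rewrite /colors size_reverse -/n.
have {}yE i : i < n -> y i = x (sigma i) by move=> /yE.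
have stepE i : i < n ->
    (y (i.+1 %% n) = conj_by (nth (0, false) (reverse s) i).2
       (y (nth (0, false) (reverse s) i).1) (y i)) <->
    (x ((n.-1 - i).+1 %% n) = conj_by (nth (0, false) s (n.-1 - i)).2
       (x (nth (0, false) s (n.-1 - i)).1) (x (n.-1 - i))).
  move=> lt_in; rewrite nth_reverse //= !yE ?(lt_sigma i) ?ltn_pmod //; last first.
    by rewrite (leq_ltn_trans _ lt_in).
  rewrite sigmaK; last by apply: valid_code_nth => //; rewrite -/n; lia.
  rewrite sigmaS //; apply: iff_trans (conj_byV _ _ _ _) _.
  have -> : sigma i = (n.-1 - i).+1 %% n by rewrite /sigma; congr (_ %% _); lia.
  by rewrite negbK.
split=> [xs i lt_in|ys i lt_in]; first by apply/stepE => //; apply: xs; lia.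
have := ys (n.-1 - i); rewrite stepE; last by lia.
have -> : n.-1 - (n.-1 - i) = i by lia.
by apply; lia.
Qed.

(** At the first crossing the under-arcs are 0 and 1. If the over-arc is one of
    them then the relation says that they are equal, and they can be merged, which
    lowers all other numbers by one. A code of length 1 is left alone: its two
    under-arcs are the same. *)
Definition collapsible (s : code) :=
  if s is c :: s' then (c.1 <= 1) && (0 < size s') else false.

Definition collapse (s : code) : code := [seq (c.1.-1, c.2) | c <- behead s].

Lemma valid_collapse s : collapsible s -> valid_code s -> valid_code (collapse s).
Proof.
case: s => // c s /andP[_ s_gt0] /andP[_ /allP s_ok].
apply/allP => _ /mapP[d /s_ok lt_ds ->] /=; rewrite size_map.
by move: lt_ds s_gt0 => /=; lia.
Qed.

Lemma collapse_presents G s : collapsible s -> valid_code s ->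
  code_presents G s -> code_presents G (collapse s).
Proof.
case: s => // c0 s /= /andP[c0_le1 s_gt0] /= s_ok; rewrite /code_presents.
pose n := size s; have sz : size (collapse (c0 :: s)) = n by rewrite size_map.
pose alpha : seq nword := [seq letter_word i.+1 | i <- iota 0 n].
pose beta : seq nword := [seq letter_word i.-1 | i <- iota 0 n.+1].
have alphaE (H : groupType) (x : nat -> H) i :
    ev x (nth [::] alpha i) = if i < n then x i.+1 else 1.
  have [lt_in|le_ni] := ltnP i n; last by rewrite nth_default ?size_map ?size_iota.
  by rewrite (nth_map 0) ?size_iota // nth_iota //= mulg1.
have betaE (H : groupType) (x : nat -> H) i :
    ev x (nth [::] beta i) = if i < n.+1 then x i.-1 else 1.
  have [lt_in|le_ni] := ltnP i n.+1; last by rewrite nth_default ?size_map ?size_iota.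
  by rewrite (nth_map 0) ?size_iota // nth_iota //= mulg1.
have modelE (H : groupType) (x : nat -> H) :
    model n.+1 (code_relators (c0 :: s)) x <->
    (forall i, n < i -> x i = 1) /\ colors (c0 :: s) x.
  exact: (model_code (c0 :: s) x).
have modelE' (H : groupType) (x : nat -> H) :
    model n (code_relators (collapse (c0 :: s))) x <->
    (forall i, n <= i -> x i = 1) /\ colors (collapse (c0 :: s)) x.
  by have := model_code (collapse (c0 :: s)) x; rewrite sz prednK.
rewrite -[(size (c0 :: s)).-1.+1]/n.+1 sz prednK //.
have next i : i < n -> i.+1 %% n = (i.+2 %% n.+1).-1.
  rewrite leq_eqVlt => /predU1P[->|lt_in]; first by rewrite !modnn.
  by rewrite !modn_small.
have nthE i : i < n -> nth (0, false) (collapse (c0 :: s)) i =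
    ((nth (0, false) s i).1.-1, (nth (0, false) s i).2).
  by move=> lt_in; rewrite (nth_map (0, false)).
have lt_nth i : i < n -> (nth (0, false) s i).1 < n.+1.
  by move=> lt_in; apply: (@valid_code_nth _ i.+1 s_ok).
apply: (presents_change (alpha := alpha) (beta := beta)).
- move=> H x /modelE[x0 xs] y.
  have x01 : x 1%N = x 0.
    have := xs 0 isT; rewrite /= modn_small //.
    case: (c0) c0_le1 => [[|[|//]] e] /= _; rewrite /conj_by; case: e => //.
    - by rewrite mulVg mul1g.
    - by rewrite mulgK.
    - by move/(congr1 (mul (x 1%N))); rewrite -mulgA mulVKg => /mulIg.
    - by move/(congr1 (mul^~ (x 1%N))); rewrite mulgVK => /mulgI.
  have yE i : i < n.+1 -> y i.-1 = x i.
    case: i => [|i] lt_in; rewrite /y alphaE; last by rewrite [_ < _]lt_in.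
    by rewrite s_gt0.
  split=> [|i].
    apply/modelE'; split; first by move=> i le_ni; rewrite /y alphaE ltnNge le_ni.
    move=> i; rewrite sz => lt_in; rewrite next // nthE //= !yE ?ltn_mod ?lt_nth //.
    by rewrite (yE i.+1) // (xs i.+1).
  by rewrite betaE; have [/yE|/x0] := ltnP i n.+1.
- move=> H y /modelE'[y0 ys] x.
  have xE i : i < n.+1 -> x i = y i.-1 by move=> lt_in; rewrite /x betaE lt_in.
  split=> [|i].
    apply/modelE; split; first by move=> i lt_ni; rewrite /x betaE ltnNge lt_ni.
    move=> [_|i lt_in] /=.
      rewrite modn_small // !xE //; last by rewrite (leq_ltn_trans c0_le1).
      have -> : c0.1.-1 = 0 by case: (c0.1) c0_le1 => [|[|]].
      by rewrite /conj_by mulVg mul1g mulgK; case: ifP.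
    have := ys i; rewrite sz => /(_ lt_in); rewrite next // nthE //=.
    by rewrite !xE ?ltn_mod ?lt_nth.
  by rewrite alphaE; have [lt_in|/y0] := ltnP i n; rewrite ?xE.
Qed.

(** * The groups of all codes with at most four crossings *)

Definition rotations (s : code) : seq code := traject rotate s (size s).+1.

Lemma rotations_presents G s t : valid_code s -> code_presents G s ->
  t \in rotations s -> [/\ valid_code t, size t = size s & code_presents G t].
Proof.
move=> s_ok Gs /trajectP[k _ ->]; elim: k => [|k [t_ok sz_t Gt]] //.
rewrite iterS size_rotate; split=> //; first exact: valid_rotate.
exact: rotate_presents.
Qed.

Definition variants (s : code) : seq code :=
  flatten [seq rotations t
          | t <- [:: s; mirror s; reverse s; mirror (reverse s)]].

Lemma variants_presents G s t : valid_code s -> code_presents G s ->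
  t \in variants s -> code_presents G t.
Proof.
move=> s_ok Gs /flatten_mapP[u u_in].
have {u_in} [u_ok Gu] : valid_code u /\ code_presents G u.
  have [r_ok Gr] := (valid_reverse s, reverse_presents s_ok Gs).
  move: u_in; rewrite !inE => /or4P[] /eqP -> //; split=> //.
  - exact: valid_mirror.
  - exact: mirror_presents.
  - exact: valid_mirror.
  - exact: mirror_presents.
by case/(rotations_presents u_ok Gu).
Qed.

Definition incollapsible (s : code) := ~~ has collapsible (rotations s).

(** Every collapse shortens the code. *)
Lemma code_presents_incollapsible G s : valid_code s -> code_presents G s ->
  exists t, [/\ valid_code t, size t <= size s, code_presents G t & incollapsible t].
Proof.
have [n] := ubnP (size s); elim: n => // n IHn in s *; rewrite ltnS => le_sn.
move=> s_ok Gs; have [red_s|/negPn/hasP[u s_u u_c]] := boolP (incollapsible s).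
  by exists s.
have [u_ok sz_u Gu] := rotations_presents s_ok Gs s_u.
have lt_us : size (collapse u) < size s.
  by rewrite -sz_u size_map size_behead; case: (u) u_c.
have [t [t_ok le_tu Gt red_t]] := IHn _ (leq_trans lt_us le_sn)
  (valid_collapse u_c u_ok) (collapse_presents u_c u_ok Gu).
by exists t; split=> //; apply: leq_trans le_tu (ltnW lt_us).
Qed.

Fixpoint all_seqs (T : Type) (a : seq T) k : seq (seq T) :=
  if k is k'.+1 then [seq c :: s | c <- a, s <- all_seqs a k'] else [:: [::]].

Lemma mem_all_seqs (T : eqType) (a s : seq T) :
  {subset s <= a} -> s \in all_seqs a (size s).
Proof.
elim: s => //= c s IHs sa; apply/allpairsP; exists (c, s); split=> //=.
  by apply: sa; rewrite mem_head.
by apply: IHs => d s_d; apply: sa; rewrite inE s_d orbT.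
Qed.

Definition all_codes k : seq code :=
  all_seqs [seq (i, b) | i <- iota 0 k, b <- [:: false; true]] k.

(** The enumeration lets a statement on all codes be decided by evaluation. *)
Lemma mem_all_codes s : valid_code s -> s \in all_codes (size s).
Proof.
move=> /allP s_ok; apply: mem_all_seqs => -[i b] s_c; apply/allpairsP.
exists (i, b); split=> //=; first by rewrite mem_iota (s_ok _ s_c).
by case: b {s_c}.
Qed.

(** Words are written as strings: a small letter is a generator, the capital
    letter its inverse. Numbering starts at a for the arcs of a diagram, and at x,
    which is 23 letters after a, for other presentations. A code is a sequence of
    signed arcs, and is written in the same way: capitals are positive crossings. *)
Definition letter_of (c : Ascii.ascii) : nat * bool :=
  let k := Ascii.nat_of_ascii c in
  let capital := k < 97 in
  let i := if capital then k + 32 - 97 else k - 97 in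
  (if i < 23 then i else i - 23, capital).

Fixpoint word_of (w : String.string) : nword :=
  if w is String.String c w' then letter_of c :: word_of w' else [::].

Section Classification.
Local Open Scope nat_scope.

Definition equation (u v : String.string) : nword :=
  word_of u ++ formal_inv (word_of v).

(** Number 0 is the infinite cyclic group, and number i is the group Gi. *)
Definition listed_presentations : seq (nat * seq nword) :=
  [:: (1, [::]);
      (2, [:: equation "xyx" "yxy"]);
      (2, [:: equation "Xyx" "Y"; equation "yyy" ""]);
      (2, [:: equation "xyx" "yxy"; equation "y" "XXXyxxx"]);
      (2, [:: equation "XyxYx" "yXyxY"]);
      (2, [:: equation "Xyx" "Y"; equation "yyyyy" ""]);
      (2, [:: equation "Xyx" "yy"; equation "yyyyy" ""]);
      (2, [:: equation "Xyx" "Yxy"]);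
      (2, [:: equation "Xyx" "yy"; equation "yyyyyyy" ""]);
      (2, [:: equation "xyxYX" "yXyxY"; equation "XYxyx" "YXyxy"])].

Definition listed k := nth (0, [::]) listed_presentations k.

Definition derivation_of (d : seq (String.string * nat * bool)) : derivation :=
  [seq (word_of c.1.1, c.1.2, c.2) | c <- d].

Definition entry (s : String.string) (k : nat) (alpha beta : seq String.string)
    (d1 d2 d3 : seq (seq (String.string * nat * bool))) :=
  (word_of s, k,
   Certificate (map word_of alpha) (map word_of beta) (map derivation_of d1)
     (map derivation_of d2) (map derivation_of d3) [seq [::] | _ <- alpha]).

(** The incollapsible codes up to moves. The generators of the target are two
    arcs or their inverses, except in G2, G5, G6, G8, where the second one is a
    quotient of two arcs; for the infinite cyclic group all arcs are shown to
    be equal. The derivations can be found by Knuth-Bendix completion of the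
    relators, keeping track of the relators that each new rule uses. *)
Definition table : seq (code * nat * certificate) := [::
  entry "" 0 [:: "a"] [:: "x"]
    [::]
    [::]
    [:: [::]];
  entry "a" 0 [:: "a"] [:: "x"]
    [::]
    [:: [::]]
    [:: [::]];
  entry "cab" 1 [:: "a"; "c"] [:: "x"; "yxY"; "y"]
    [:: [:: ("a", 0, false); ("", 1, false)]]
    [:: [::]; [:: ("", 0, false)]; [:: ("", 0, true)]]
    [:: [::]; [:: ("", 0, false)]; [::]];
  entry "caB" 2 [:: "a"; "cA"] [:: "x"; "yxY"; "yx"]
    [:: [:: ("AccAC", 0, true); ("Ac", 2, false); ("A", 1, true)];
       [:: ("cAC", 0, true); ("", 2, false); ("a", 2, false);
       ("aaBA", 1, true)]]
    [:: [::]; [:: ("xx", 0, false); ("xx", 1, true); ("xxy", 0, false);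
       ("x", 0, true)]; [:: ("", 1, false); ("Yx", 0, true)]]
    [:: [::]; [:: ("", 0, false)]; [::]];
  entry "caab" 0 [:: "a"] [:: "x"; "x"; "x"; "x"]
    [::]
    [:: [::]; [::]; [::]; [::]]
    [:: [::]; [:: ("", 1, true); ("abAAC", 0, false); ("abABA", 1, false);
       ("abABA", 3, false); ("abAD", 2, false); ("abAC", 0, false);
       ("", 1, false)]; [:: ("D", 2, true); ("BA", 3, true); ("BA", 1, true);
       ("AC", 0, true); ("aBA", 1, false); ("", 1, true); ("abAAC", 0, false);
       ("abABA", 1, false); ("abABA", 3, false); ("abAD", 2, false);
       ("abAC", 0, false); ("", 1, false)]; [:: ("aBA", 3, true);
       ("aBA", 1, true); ("C", 0, true); ("D", 2, true); ("BA", 3, true);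
       ("BA", 1, true); ("AC", 0, true); ("aBA", 1, false); ("", 1, true);
       ("abAAC", 0, false); ("abABA", 1, false); ("abABA", 3, false);
       ("abAD", 2, false); ("abAC", 0, false); ("", 1, false)]];
  entry "caaB" 3 [:: "A"; "B"] [:: "X"; "Y"; "XYx"; "XXYxx"]
    [:: [:: ("ABA", 1, true); ("AAC", 0, true); ("BA", 1, false)];
       [:: ("B", 1, false); ("B", 0, false); ("", 1, true); ("abA", 3, false);
       ("aD", 2, false); ("aaaBA", 1, false)]]
    [:: [:: ("XYX", 0, true)]; [::]; [::]; [:: ("yxY", 1, false);
       ("X", 0, false)]]
    [:: [::]; [::]; [:: ("", 1, false)]; [:: ("a", 1, false); ("", 2, false)]];
  entry "caac" 1 [:: "a"; "c"] [:: "x"; "yxY"; "y"; "xyX"]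
    [:: [:: ("a", 0, false); ("", 1, false)]]
    [:: [::]; [:: ("", 0, false)]; [::]; [:: ("", 0, true)]]
    [:: [::]; [:: ("", 0, false)]; [::]; [:: ("", 2, false)]];
  entry "caaC" 2 [:: "b"; "Bc"] [:: "Yxy"; "x"; "xy"; "Yxyy"]
    [:: [:: ("BcAC", 0, false); ("BA", 2, false); ("BAc", 3, false);
       ("BA", 1, true)]; [:: ("cAC", 0, false); ("A", 2, false);
       ("Ac", 3, false); ("A", 0, false); ("AB", 0, true); ("AB", 1, true);
       ("ABc", 3, false); ("AB", 0, false); ("AD", 2, false)]]
    [:: [::]; [:: ("Yx", 0, true); ("x", 1, false); ("xYx", 0, true)];
       [::]; [:: ("", 0, true); ("", 1, false)]]
    [:: [:: ("C", 0, true)]; [::]; [::]; [:: ("C", 0, true);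
       ("acAC", 0, false); ("", 2, false)]];
  entry "caAb" 0 [:: "d"] [:: "x"; "x"; "x"; "x"]
    [::]
    [:: [::]; [::]; [::]; [::]]
    [:: [:: ("", 2, true); ("A", 1, true); ("bA", 1, false); ("b", 2, false);
       ("", 3, false)]; [:: ("", 2, true); ("A", 1, true)];
       [:: ("", 2, true); ("A", 0, false); ("AbA", 1, false);
       ("Ab", 2, false); ("A", 3, false)]; [::]];
  entry "caAB" 0 [:: "a"] [:: "x"; "x"; "x"; "x"]
    [::]
    [:: [::]; [::]; [::]; [::]]
    [:: [::]; [:: ("", 3, true); ("B", 2, true); ("BA", 1, true)];
       [:: ("abA", 3, true); ("abAB", 2, true); ("abABA", 1, true);
       ("", 1, false)]; [:: ("aBA", 1, false); ("aB", 2, false);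
       ("", 3, true);
       ("B", 2, true); ("BA", 1, true)]];
  entry "caAC" 1 [:: "a"; "c"] [:: "x"; "yxY"; "y"; "Xyx"]
    [:: [:: ("a", 0, false); ("", 1, false)]]
    [:: [::]; [:: ("", 0, false)]; [::]; [:: ("YX", 0, true)]]
    [:: [::]; [:: ("", 0, false)]; [::]; [:: ("", 2, false)]];
  entry "cabb" 0 [:: "a"] [:: "x"; "x"; "x"; "x"]
    [::]
    [:: [::]; [::]; [::]; [::]]
    [:: [::]; [:: ("C", 0, false); ("C", 2, false); ("CB", 3, false);
       ("CB", 1, false); ("CB", 0, false)]; [:: ("", 1, false);
       ("", 0, false); ("", 2, false); ("B", 3, false); ("B", 1, false);
       ("B", 0, false)]; [:: ("", 1, false); ("", 0, false); ("", 2, false)]];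
  entry "cabB" 0 [:: "a"] [:: "x"; "x"; "x"; "x"]
    [::]
    [:: [::]; [::]; [::]; [::]]
    [:: [::]; [:: ("aBA", 1, true); ("C", 3, true); ("CB", 2, true)];
       [:: ("", 3, true); ("B", 2, true)]; [:: ("", 1, false); ("", 0, false);
       ("", 2, false)]];
  entry "caBB" 3 [:: "B"; "A"] [:: "Y"; "X"; "YXy"; "xYXyX"]
    [:: [:: ("BA", 1, true); ("AAC", 0, false); ("ABA", 1, false)];
       [:: ("Abbb", 3, true); ("Abb", 2, true); ("A", 0, true); ("A", 1, true)]]
    [:: [:: ("XYX", 0, false)]; [::]; [::]; [:: ("xxYX", 0, true);
       ("xxxY", 1, true)]]
    [:: [::]; [::]; [:: ("", 1, false)]; [:: ("B", 1, false); ("", 2, false)]];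
  entry "cAab" 0 [:: "d"] [:: "x"; "x"; "x"; "x"]
    [::]
    [:: [::]; [::]; [::]; [::]]
    [:: [:: ("", 2, true); ("a", 1, true); ("ba", 1, false); ("b", 2, false);
       ("", 3, false)]; [:: ("", 2, true); ("a", 1, true)];
       [:: ("", 2, true); ("", 3, true); ("b", 2, true); ("ba", 1, true);
       ("", 0, true)]; [::]];
  entry "cAaB" 0 [:: "d"] [:: "x"; "x"; "x"; "x"]
    [::]
    [:: [::]; [::]; [::]; [::]]
    [:: [:: ("", 2, true); ("a", 1, true); ("Ba", 1, false); ("B", 2, false);
       ("", 3, false)]; [:: ("", 2, true); ("a", 1, true)];
       [:: ("", 2, true); ("", 3, true); ("B", 2, true); ("Ba", 1, true);
       ("", 0, true)]; [::]];
  entry "cAaC" 7 [:: "A"; "C"] [:: "X"; "YXy"; "Y"; "XYx"]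
    [:: [:: ("aC", 1, false); ("B", 0, false)]]
    [:: [::]; [:: ("Yx", 0, false)]; [::]; [:: ("yXYx", 0, true)]]
    [:: [::]; [:: ("", 0, false)]; [::]; [:: ("", 2, false)]];
  entry "cAAb" 6 [:: "c"; "bC"] [:: "Xyxx"; "yx"; "x"; "XXYxyxx"]
    [:: [:: ("C", 0, true); ("acAC", 0, false); ("a", 1, true)];
       [:: ("a", 1, false); ("acAC", 0, true); ("Ba", 1, false);
       ("B", 3, true);
       ("", 2, true); ("A", 0, false); ("Aba", 1, false); ("AbacAC", 0, true);
       ("", 1, false)]]
    [:: [::]; [:: ("XYY", 0, true)]; [::]; [:: ("Y", 0, true);
       ("xYXYY", 0, true); ("xYYY", 0, true); ("xY", 1, true);
       ("x", 0, true)]]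
    [:: [:: ("C", 0, true)]; [::]; [::]; [:: ("AC", 0, false); ("A", 0, true);
       ("", 2, false)]];
  entry "cAAB" 8 [:: "a"; "Ab"] [:: "x"; "xy"; "yx"; "Xyxx"]
    [:: [:: ("AAb", 3, true); ("AAdacAC", 0, false); ("AAda", 1, true);
       ("AAb", 3, false); ("A", 1, false)]; [:: ("Ab", 1, false);
       ("AbcAC", 0, true); ("A", 1, true); ("AAbb", 1, false);
       ("AAbbcAC", 0, true); ("AAbcAC", 0, true); ("AAB", 0, true);
       ("AABa", 2, false); ("AABa", 1, true); ("AC", 0, true);
       ("C", 3, false); ("C", 0, true); ("aC", 1, false)]]
    [:: [:: ("x", 0, false)]; [::]; [::]; [:: ("YX", 0, false);
       ("Y", 0, false); ("y", 0, false); ("y", 1, false); ("XyxYY", 0, true);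
       ("Xyxy", 1, true); ("", 0, false); ("x", 0, false); ("xyy", 0, false);
       ("x", 1, false); ("xYYY", 0, false)]]
    [:: [::]; [::]; [:: ("", 1, false)]; [:: ("A", 1, false); ("", 2, false)]];
  entry "cAAc" 2 [:: "b"; "aB"] [:: "yx"; "x"; "XYxyx"; "XYXYxyxyx"]
    [:: [:: ("Ba", 1, true); ("aC", 3, true); ("a", 2, true); ("", 0, false)];
       [:: ("aBa", 1, true); ("aC", 0, false); ("aC", 3, true);
       ("a", 2, true); ("", 0, false)]]
    [:: [:: ("XYx", 0, true); ("", 1, false)]; [::]; [::]; [:: ("X", 1, true);
       ("", 0, false)]]
    [:: [::]; [::]; [:: ("", 1, false)]; [:: ("A", 1, false); ("", 2, false)]];
  entry "cAbb" 6 [:: "a"; "Ac"] [:: "x"; "xyxYX"; "xy"; "xyxxyXYX"]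
    [:: [:: ("AA", 0, false); ("A", 1, false)]; [:: ("A", 1, true);
       ("AA", 0, true); ("AAc", 1, true); ("AA", 1, true); ("AAAb", 0, true);
       ("AAA", 2, false); ("AAAB", 3, false); ("AAABa", 1, true);
       ("AAC", 0, true); ("AC", 0, true)]]
    [:: [::]; [:: ("x", 0, false)]; [::]; [:: ("xyxxxy", 0, false);
       ("xyxxx", 1, false); ("xyxxxYY", 0, false); ("xyxYx", 0, false);
       ("xx", 0, false)]]
    [:: [::]; [:: ("", 0, false)]; [::]; [:: ("cacAC", 0, true);
       ("", 0, false); ("", 2, false)]];
  entry "cAbB" 0 [:: "c"] [:: "x"; "x"; "x"; "x"]
    [::]
    [:: [::]; [::]; [::]; [::]]
    [:: [:: ("", 0, false); ("", 2, false); ("b", 3, false); ("", 2, false);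
       ("b", 3, false); ("a", 1, false)]; [:: ("", 0, false); ("", 2, false);
       ("b", 3, false)]; [::]; [:: ("", 0, false); ("", 2, false);
       ("d", 2, false); ("db", 3, false); ("da", 1, false)]];
  entry "cABb" 0 [:: "a"] [:: "x"; "x"; "x"; "x"]
    [::]
    [:: [::]; [::]; [::]; [::]]
    [:: [::]; [:: ("ab", 2, false); ("a", 3, false); ("", 3, true);
       ("b", 2, true); ("", 0, false)]; [:: ("", 3, true); ("b", 2, true)];
       [:: ("aDA", 3, true); ("aDA", 0, true); ("aDAb", 2, false);
       ("aDA", 3, false); ("aD", 3, true); ("aDb", 2, true); ("ab", 2, false);
       ("a", 3, false); ("", 3, true); ("b", 2, true); ("", 0, false)]];
  entry "cdab" 9 [:: "C"; "A"] [:: "Y"; "XYx"; "X"; "YXy"]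
    [:: [:: ("CA", 2, true); ("ABD", 1, false); ("ABD", 2, false);
       ("AB", 0, false)]; [:: ("", 0, false); ("bACa", 0, false);
       ("bAC", 3, true); ("bAC", 0, true); ("bC", 1, false); ("", 3, false)]]
    [:: [::]; [:: ("XYX", 0, false)]; [::]; [:: ("XYxYX", 0, true);
       ("XYxx", 1, true); ("XYxY", 0, false)]]
    [:: [::]; [:: ("", 0, false)]; [::]; [:: ("", 2, false)]];
  entry "cdaB" 5 [:: "a"; "Ad"] [:: "x"; "yxY"; "yx"; "xy"]
    [:: [:: ("AA", 2, true); ("AB", 0, true); ("AB", 1, true);
       ("A", 3, false)]; [:: ("A", 2, true); ("B", 0, true); ("BB", 0, true);
       ("BB", 1, true); ("B", 3, false); ("", 3, false); ("aBA", 2, true);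
       ("aB", 0, false); ("acAA", 3, false); ("acABD", 1, true);
       ("acADC", 0, true); ("acAD", 2, false); ("aCA", 2, true)]]
    [:: [::]; [:: ("xyx", 0, false); ("xx", 0, false); ("xx", 1, true);
       ("xxy", 0, false); ("x", 0, true)]; [::]; [:: ("y", 0, false);
       ("XYYx", 0, true); ("XYx", 0, true); ("", 1, false); ("Yx", 0, true)]]
    [:: [::]; [:: ("A", 2, true); ("", 0, false); ("bA", 2, false)];
       [:: ("A", 2, true)]; [::]];
  entry "cdAB" 5 [:: "c"; "Ca"] [:: "xy"; "xxyX"; "x"; "Yxy"]
    [:: [:: ("AC", 0, false); ("AdBD", 1, false); ("AdA", 3, true);
       ("A", 2, true)]; [:: ("aD", 2, true); ("aBD", 1, false); ("", 3, true);
       ("cAC", 0, false); ("cD", 2, true); ("", 1, true); ("b", 3, false);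
       ("baD", 2, false); ("bAC", 0, false); ("bACb", 3, true);
       ("bAC", 1, false); ("bD", 2, true); ("D", 1, false); ("DC", 0, false);
       ("DCb", 3, true); ("DC", 1, false)]]
    [:: [::]; [:: ("Yx", 0, true); ("xyx", 0, false); ("xx", 0, false);
       ("xxYYx", 0, true); ("xxYx", 0, true); ("xxx", 1, false);
       ("xxxY", 0, true); ("xxx", 0, true); ("xxy", 0, false)]; [::];
       [:: ("x", 0, true); ("y", 0, false); ("XYYx", 0, true);
       ("XYx", 0, true); ("", 1, false); ("YYx", 0, true); ("Yx", 0, true);
       ("xyx", 0, false)]]
    [:: [::]; [:: ("", 0, false)]; [::]; [:: ("", 2, false)]];
  entry "cDaB" 4 [:: "a"; "c"] [:: "x"; "yxY"; "y"; "xyX"]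
    [:: [:: ("A", 0, false); ("Ab", 2, false); ("Ad", 1, false);
       ("A", 2, true)]]
    [:: [::]; [:: ("xY", 0, false)]; [::]; [:: ("yXYx", 0, true)]]
    [:: [::]; [:: ("", 0, false)]; [::]; [:: ("", 2, false)]]
].

HB.instance Definition _ := gen_eqMixin certificate.

Definition table_ok (T : seq (code * nat * certificate)) :=
  all (fun e => (e.1.2 < 10) &&
         certified (size e.1.1).-1.+1 (code_relators e.1.1)
           (listed e.1.2).1 (listed e.1.2).2 e.2) T &&
  all (fun k => all (fun s => if incollapsible s then
                               has (mem [seq e.1.1 | e <- T]) (variants s)
                             else true) (all_codes k)) (iota 0 5).

(** The three parts of the argument meet here: collapse, look up the code up to
    moves, and apply the certificate found there. *)
Lemma table_classifies T G s :
    table_ok T -> valid_code s -> size s <= 4 -> code_presents G s ->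
  exists2 k, k < 10 & presents G (listed k).1 (listed k).2.
Proof.
move=> /andP[/allP certT /allP redT] s_ok s_le4 Gs.
have [t [t_ok le_ts Gt red_t]] := code_presents_incollapsible s_ok Gs.
have t_le4 : size t \in iota 0 5 by rewrite mem_iota ltnS (leq_trans le_ts).
have := allP (redT _ t_le4) t (mem_all_codes t_ok); rewrite red_t.
move=> /hasP[u t_u /mapP[e T_e def_u]].
have /andP[lt10 e_ok] := certT e T_e; exists e.1.2 => //.
apply: certified_presents e_ok _; rewrite -def_u.
exact: variants_presents t_ok Gt t_u.
Qed.

Lemma table_checked : table_ok table.
Proof. by vm_compute. Qed.

End Classification.

Section IntegerPower.
Variables (G : groupType) (x : G).

Definition zpow (m : int) : G :=
  match m with Posz k => x ^+ k | Negz k => x ^- k.+1 end.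

Lemma zpowS m : zpow (m + 1)%R = x * zpow m.
Proof.
case: m => [k|[|k]].
- have -> : (Posz k + 1 = k.+1)%R by lia.
  exact: expgS.
- by rewrite /= mulgV.
have -> : (Negz k.+1 + 1 = Negz k)%R by lia.
by rewrite /= [X in _ * X^-1]expgSr invgM mulVKg.
Qed.

Lemma zpowD : {morph zpow : m n / (m + n)%R >-> m * n}.
Proof.
move=> m n; elim: m => [|m IHm|m IHm]; first by rewrite GRing.add0r mul1g.
  have -> : (m.+1%:Z + n = (m%:Z + n) + 1)%R by lia.
  by rewrite zpowS IHm mulgA -zpowS; congr (zpow _ * _); lia.
have shift k : zpow (k - 1)%R = x^-1 * zpow k.
  by rewrite -[k in RHS](@GRing.subrK int 1%R) zpowS mulKg.
have -> : (- m.+1%:Z + n = (- m%:Z + n) - 1)%R by lia.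
by rewrite shift IHm mulgA -shift; congr (zpow _ * _); lia.
Qed.

End IntegerPower.

Lemma infinite_cyclic_presents : presents infinite_cyclic 1 [::].
Proof.
pose t (i : nat) : infinite_cyclic := if i is 0 then 1%R : int else 0%R : int.
exists t; split.
- by split=> // -[].
- have tk k : ev t (nseq k (0, false)) = Posz k :> infinite_cyclic.
    by elim: k => //= k ->; rewrite -[RHS](PoszD 1%N k).
  case=> k; first by exists (nseq k (0, false)).
  exists (formal_inv (nseq k.+1 (0, false))).
  by rewrite ev_formal_inv tk NegzE.
- move=> H x [x0 _].
  have fM : {morph (zpow (x 0) : infinite_cyclic -> H) : m n / m * n}.
    exact: zpowD.
  exists (multiplicative_of fM) => -[|i] //=.
  by rewrite (x0 i.+1).
Qed.

Definition listed_group k : groupType :=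
  nth (infinite_cyclic : groupType)
    [:: infinite_cyclic : groupType; G1; G2; G3; G4; G5; G6; G7; G8; G9] k.

Lemma listed_presents k : k < 10 ->
  presents (listed_group k) (listed k).1 (listed k).2.
Proof.
have inord0 : inord 0 = ord0 :> 'I_2 by apply: val_inj; rewrite /= inordK.
have inord1 : inord 1 = lift ord0 ord0 :> 'I_2 by apply: val_inj; rewrite /= inordK.
case: k => [_|k]; first exact: infinite_cyclic_presents.
do 9![case: k => [_|k]; first by
  rewrite /listed_group /= /G1 /G2 /G3 /G4 /G5 /G6 /G7 /G8 /G9 ?inord0 inord1;
  apply: presented_presents].
by [].
Qed.

(** * Circular orders and finite subgroups *)

(** The coboundary of the sign of the difference is automatically a cocycle, and
    takes the right values since it only depends on the order of three elements. *)
Lemma left_orderable_circularly G : left_orderable G -> circularly_orderable G.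
Proof.
move=> [lt [ltxx lt_tr lt_tot ltM]].
have lt_asym g h : lt g h -> lt h g -> False.
  by move=> gh hg; apply/(ltxx g)/(lt_tr _ _ _ gh hg).
pose sgn g h : int := ((`[< lt g h >] : nat)%:Z - (`[< lt h g >] : nat)%:Z)%R.
have sgnE g h : [/\ g = h & sgn g h = 0%R] \/
    (lt g h /\ sgn g h = 1%R) \/ (lt h g /\ sgn g h = (-1)%R).
  have [<-|/eqP ne_gh] := eqVneq g h; first by left; rewrite /sgn GRing.subrr.
  right; have [gh|hg] := lt_tot g h ne_gh; [left|right]; rewrite /sgn; split=> //.
    by rewrite (asboolT gh) asboolF // => hg; apply: lt_asym gh hg.
  by rewrite (asboolT hg) asboolF // => gh; apply: lt_asym gh hg.
have sgnC g h : (sgn g h = - sgn h g)%R by rewrite /sgn; lia.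
pose c g1 g2 g3 : int := (sgn g1 g2 + sgn g2 g3 - sgn g1 g3)%R.
have cE g1 g2 g3 : [/\ g1 <> g2, g1 <> g3, g2 <> g3 &
    c g1 g2 g3 = 1%R \/ c g1 g2 g3 = (-1)%R] \/
    [\/ g1 = g2, g1 = g3 | g2 = g3] /\ c g1 g2 g3 = 0%R.
  rewrite /c.
  have [[<- s12]|s12] := sgnE g1 g2.
    by right; split; [constructor 1|rewrite s12; lia].
  have [[<- s23]|s23] := sgnE g2 g3.
    by right; split; [constructor 3|rewrite s23; lia].
  have [[e13 s13]|s13] := sgnE g1 g3.
    by right; split; [constructor 2|rewrite s13 -e13 sgnC; lia].
  left; split; last first.
  - move: s12 s23 s13 => [[l12 ->]|[l12 ->]] [[l23 ->]|[l23 ->]] [[l13 ->]|[l13 ->]];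
      try (by left; lia); try (by right; lia).
    + by case: (lt_asym _ _ l13); apply: lt_tr l12 l23.
    + by case: (lt_asym _ _ l13); apply: lt_tr l23 l12.
  - by move=> e; move: s23; rewrite e => -[] [ll _]; apply: ltxx ll.
  - by move=> e; move: s13; rewrite e => -[] [ll _]; apply: ltxx ll.
  - by move=> e; move: s12; rewrite e => -[] [ll _]; apply: ltxx ll.
have sgnM h g1 g2 : sgn (h * g1) (h * g2) = sgn g1 g2.
  have ltE k1 k2 : `[< lt (h * k1) (h * k2) >] = `[< lt k1 k2 >].
    by apply/asboolP/asboolP => [/(proj2 (ltM h _ _))|/(proj1 (ltM h _ _))].
  by rewrite /sgn !ltE.
exists c; split=> [g1 g2 g3|g1 g2 g3|g1 g2 g3 g4|h g1 g2 g3].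
- case: (cE g1 g2 g3) => [[_ _ _ [->|->]]|[_ ->]].
  + by constructor 3.
  + by constructor 1.
  + by constructor 2.
- case: (cE g1 g2 g3) => [[n12 n13 n23 c123]|[e ->]]; split=> //.
  + by case: c123 => ->.
  + by case=> [/n12|/n13|/n23].
- by rewrite /c; lia.
- by rewrite /c !sgnM.
Qed.

Lemma isomorphic_circularly_orderable G H :
  isomorphic G H -> circularly_orderable G -> circularly_orderable H.
Proof.
move=> /isomorphic_sym[f bij_f] [c [c_val c_eq c_coc cM]].
exists (fun g1 g2 g3 => c (f g1) (f g2) (f g3)); split=> //.
- move=> g1 g2 g3; rewrite c_eq; split=> -[e|e|e].
  + by constructor 1; apply: (bij_inj bij_f).
  + by constructor 2; apply: (bij_inj bij_f).
  + by constructor 3; apply: (bij_inj bij_f).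
  + by constructor 1; rewrite e.
  + by constructor 2; rewrite e.
  + by constructor 3; rewrite e.
- by move=> h g1 g2 g3; rewrite !gmulfM.
Qed.

Lemma isomorphic_left_orderable G H :
  isomorphic G H -> left_orderable G -> left_orderable H.
Proof.
move=> /isomorphic_sym[f bij_f] [lt [ltxx lt_tr lt_tot ltM]].
exists (fun g h => lt (f g) (f h)); split=> //.
- by move=> g1 g2 g3; apply: lt_tr.
- by move=> g h ne_gh; apply: lt_tot => /(bij_inj bij_f).
- by move=> h g1 g2; rewrite !gmulfM.
Qed.

Section FiniteSubgroup.
Variables (G : groupType) (c : G -> G -> G -> int).
Hypothesis c_val : forall g1 g2 g3,
  [\/ c g1 g2 g3 = (- 1)%R, c g1 g2 g3 = 0%R | c g1 g2 g3 = 1%R].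
Hypothesis c_eq : forall g1 g2 g3,
  c g1 g2 g3 = 0%R <-> [\/ g1 = g2, g1 = g3 | g2 = g3].
Hypothesis c_coc : forall g1 g2 g3 g4,
  (c g2 g3 g4 - c g1 g3 g4 + c g1 g2 g4 - c g1 g2 g3 = 0)%R.
Hypothesis cM : forall h g1 g2 g3, c g1 g2 g3 = c (h * g1) (h * g2) (h * g3).

Variable A : seq G.
Hypothesis A_uniq : uniq A.
Hypothesis A1 : 1 \in A.
Hypothesis AM : forall g h, g \in A -> h \in A -> g * h \in A.

Lemma perm_map_closed (f : G -> G) :
  injective f -> (forall g, g \in A -> f g \in A) -> perm_eq (map f A) A.
Proof.
move=> f_inj fA.
have fA_uniq : uniq (map f A) by rewrite map_inj_uniq.
have sub_fA : {subset map f A <= A} by move=> _ /mapP[g Ag ->]; apply: fA.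
apply: uniq_perm => //.
by have [] := uniq_min_size fA_uniq sub_fA (eq_leq (esym (size_map f A))).
Qed.

Lemma sum_reindex (f : G -> G) (F : G -> int) :
    injective f -> (forall g, g \in A -> f g \in A) ->
  (\sum_(t <- A) F (f t) = \sum_(t <- A) F t)%R.
Proof.
move=> f_inj fA; rewrite -(big_map f xpredT F).
exact/perm_big/perm_map_closed.
Qed.

Lemma sum_shift g (F : G -> int) : g \in A ->
  (\sum_(t <- A) F (t * g)%g = \sum_(t <- A) F t)%R.
Proof. by move=> Ag; apply: (sum_reindex F (mulIg g)) => h Ah; apply: AM. Qed.

(** If A is cyclic of order n, and g generates A and turns the circle by k / n,
    then the orbit of 1 under g winds k times, and this sum is n - 2k. *)
Definition winding (g : G) : int := (\sum_(t <- A) c 1%g t (t * g)%g)%R.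

Let n : int := Posz (size A).

Lemma sum_const (k : int) : (\sum_(t <- A) k = n * k)%R.
Proof. by rewrite big_const_seq count_predT iter_addr addr0 -mulr_natl natz. Qed.

(** Sum of the cocycle identity for 1, t, t g, t g h over t in A. *)
Lemma windingM g h : g \in A ->
  (winding g + winding h - winding (g * h)%g = n * c 1%g g (g * h)%g)%R.
Proof.
move=> Ag; rewrite /winding -(sum_shift (fun t => c 1 t (t * h)) Ag).
rewrite -big_split -sumrB -sum_const /=; apply: eq_bigr => t _.
have := c_coc 1 t (t * g) (t * (g * h)).
rewrite (cM t 1 g) mulg1 !mulgA.
by do ![move: (c _ _ _) => ?]; lia.
Qed.

(** Each term is at most 1 in absolute value, and the term of t = 1 vanishes. *)
Lemma winding_lt g : (- n < winding g < n)%R.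
Proof.
have bound (s : seq G) :
    (- Posz (size s) <= \sum_(t <- s) c 1%g t (t * g)%g <= Posz (size s))%R.
  elim: s => [|t s]; first by rewrite big_nil.
  rewrite big_cons /=; move: (\sum_(_ <- _) _)%R => k.
  by case: (c_val 1 t (t * g)) => ->; lia.
have A_gt0 : 0 < size A by case: (A) A1.
rewrite /winding (big_rem 1%g A1) /= mul1g.
have /c_eq -> : [\/ 1 = 1 :> G, 1 = g | 1 = g] by constructor 1.
rewrite add0r /n; have := bound (rem 1 A); rewrite size_rem //.
by move: (\sum_(_ <- _) _)%R (size A) A_gt0 => k m; lia.
Qed.

(** After the substitution of x^-1 t x for t, both sides sum values of c on
    triangles over the edge from t to t g, one of them translated by x. The prism
    between the triangles has one lateral face that by invariance does not depend
    on t, and two that cancel in the sum. *)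
Lemma winding_conj x g : g \in A ->
    (forall h, h \in A -> x^-1 * h * x \in A) ->
  (winding (x^-1 * g * x)%g - winding g =
   n * (c 1%g x (g * x)%g - c 1%g g (g * x)%g))%R.
Proof.
move=> Ag Ax; rewrite /winding.
have x_inj : injective (fun t => x^-1 * t * x) by move=> t u /mulIg/mulgI.
rewrite -(sum_reindex (fun t => c 1 t (t * (x^-1 * g * x))) x_inj Ax).
pose P t := (c 1%g t (t * x)%g - c 1%g x (t * x)%g)%R.
transitivity (\sum_(t <- A) (P (t * g)%g - P t +
                 (c 1%g x (g * x)%g - c 1%g g (g * x)%g)))%R; last first.
  by rewrite big_split sumrB /= (sum_shift P Ag) subrr add0r sum_const.
rewrite -sumrB; apply: eq_bigr => t _; rewrite /P.
have -> : c 1 (x^-1 * t * x) (x^-1 * t * x * (x^-1 * g * x)) =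
          c x (t * x) (t * g * x).
  by rewrite (cM x) mulg1 !mulgA mulgV mul1g mulgK.
rewrite (cM t 1 x (g * x)) (cM t 1 g (g * x)) mulg1 !mulgA.
have := c_coc 1 x (t * x) (t * g * x).
have := c_coc 1 t (t * g) (t * g * x).
have := c_coc 1 t (t * x) (t * g * x).
by do ![move: (c _ _ _) => ?]; lia.
Qed.

(** Otherwise h = g^-1 g', with g' = x^-1 g x, is a nontrivial element of A. By
    winding_conj the windings of g and g' differ by n times a difference of two
    signs, an even multiple of n, so that by windingM the winding of h is an odd
    multiple of n. This contradicts winding_lt. *)
Lemma finite_normalized_centralized x g : g \in A ->
  (forall h, h \in A -> x^-1 * h * x \in A) -> x^-1 * g * x = g.
Proof.
move=> Ag Ax; set g' := x^-1 * g * x.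
have xg' : x * g' = g * x by rewrite /g' !mulgA mulgV mul1g.
have [->|ne_g'g] := eqVneq g' g; first by [].
have ne_g1 : g <> 1.
  by move=> g1; move: ne_g'g; rewrite /g' g1 mulg1 mulVg eqxx.
have ne_x1 : x <> 1.
  by move=> x1; move: ne_g'g; rewrite /g' x1 invg1 mul1g mulg1 eqxx.
have ne_gx1 : g * x <> 1.
  move=> /mulg1_eq gx; move: ne_g'g.
  by rewrite /g' -gx invgK mulgK eqxx.
have ne_g'1 : g' <> 1.
  by move=> g'1; apply: ne_g1; apply: (mulIg x); rewrite mul1g -xg' g'1 mulg1.
have odd_c a b : a <> 1 -> b <> 1 -> a <> b -> c 1 a b = 1%R \/ c 1 a b = (-1)%R.
  move=> a1 b1 ab; case: (c_val 1 a b); [by right| |by left].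
  by move=> /c_eq[/esym|/esym|].
have := windingM (g^-1 * g') Ag; rewrite mulVKg.
have := winding_conj Ag Ax; rewrite -/g'.
have := winding_lt (g^-1 * g').
have c1 : c 1 g g' = 1%R \/ c 1 g g' = (-1)%R.
  by apply: odd_c => // e; rewrite e eqxx in ne_g'g.
have c2 : c 1 x (g * x) = 1%R \/ c 1 x (g * x) = (-1)%R.
  apply: odd_c => // e; apply: ne_g1; apply: (mulIg x).
  by rewrite mul1g.
have c3 : c 1 g (g * x) = 1%R \/ c 1 g (g * x) = (-1)%R.
  apply: odd_c => // e; apply: ne_x1; apply: (mulgI g).
  by rewrite mulg1.
by case: c1 c2 c3 => -> [] -> [] -> /andP[]; lia.
Qed.

End FiniteSubgroup.

Lemma circularly_orderable_normalized (G : groupType) (a x : G) n m :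
    circularly_orderable G -> a ^+ n.+1 = 1 -> x^-1 * a * x = a ^+ m ->
  x^-1 * a * x = a.
Proof.
move=> [c [c_val c_eq c_coc cM]] an am.
(* The order of a may be a proper divisor of n + 1, hence the undup. *)
pose A := undup [seq a ^+ i | i <- iota 0 n.+1].
have Apow i : a ^+ i \in A.
  rewrite mem_undup (divn_eq i n.+1) expgnDr mulnC expgnA an expg1n mul1g.
  by apply: map_f; rewrite mem_iota ltn_pmod.
apply: (finite_normalized_centralized c_val c_eq c_coc cM (A := A)).
- exact: undup_uniq.
- exact: (Apow 0).
- move=> g h; rewrite [g \in A]mem_undup [h \in A]mem_undup.
  move=> /mapP[i _ ->] /mapP[j _ ->].
  by rewrite -expgnDr Apow.
- exact: (Apow 1%N).
- move=> h; rewrite [h \in A]mem_undup => /mapP[i _ ->].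
  have -> : x^-1 * a ^+ i * x = (a ^+ i) ^ x by rewrite /conjg mulgA.
  by rewrite conjXg /conjg mulgA am -expgnA Apow.
Qed.

(** * Permutation representations *)

Record sym (T : Type) := Sym {
  sym_fun : T -> T;
  sym_inv : T -> T;
  sym_funK : cancel sym_fun sym_inv;
  sym_invK : cancel sym_inv sym_fun
}.

Section SymmetricGroup.
Variable T : Type.
Implicit Types f g h : sym T.

HB.instance Definition _ := gen_eqMixin (sym T).
HB.instance Definition _ := gen_choiceMixin (sym T).

Lemma sym_eq f g : sym_fun f =1 sym_fun g -> f = g.
Proof.
case: f g => f f' fK f'K [g g' gK g'K] /= /funext fg; subst g.
have e : f' = g' by apply: funext => t; rewrite -[t in LHS]g'K fK.
by subst g'; congr Sym; apply: Prop_irrelevance.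
Qed.

Definition sym_one : sym T := @Sym T id id (fun=> erefl) (fun=> erefl).

Definition sym_V f : sym T := Sym (@sym_invK _ f) (@sym_funK _ f).

Lemma sym_mulK f g :
  cancel (sym_fun f \o sym_fun g) (sym_inv g \o sym_inv f).
Proof. exact: can_comp (@sym_funK _ f) (@sym_funK _ g). Qed.

Lemma sym_mulVK f g :
  cancel (sym_inv g \o sym_inv f) (sym_fun f \o sym_fun g).
Proof. exact: can_comp (@sym_invK _ g) (@sym_invK _ f). Qed.

Definition sym_mul f g : sym T := Sym (@sym_mulK f g) (@sym_mulVK f g).

Lemma sym_mulA : associative sym_mul.
Proof. by move=> f g h; apply: sym_eq. Qed.

Lemma sym_mul1 : left_id sym_one sym_mul.
Proof. by move=> f; apply: sym_eq. Qed.

Lemma sym_mulr1 : right_id sym_one sym_mul.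
Proof. by move=> f; apply: sym_eq. Qed.

Lemma sym_mulV : left_inverse sym_one sym_V sym_mul.
Proof. by move=> f; apply: sym_eq => t; apply: sym_funK. Qed.

Lemma sym_mulrV : right_inverse sym_one sym_V sym_mul.
Proof. by move=> f; apply: sym_eq => t; apply: sym_invK. Qed.

HB.instance Definition _ := isGroup.Build (sym T)
  sym_mulA sym_mul1 sym_mulr1 sym_mulV sym_mulrV.

End SymmetricGroup.

(** Permutations of an initial segment of the natural numbers are given by the
    table of their values. The default value i makes all other numbers fixed, and
    relators can be checked by evaluation on finitely many numbers. *)
Definition act (s : seq nat) i := nth i s i.

Definition inverse_table (s : seq nat) := [seq index i s | i <- iota 0 (size s)].

Definition perm_table k s :=
  (size s == k) && all (fun i => [&& act s i < k, act (inverse_table s) i < k,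
    act (inverse_table s) (act s i) == i & act s (act (inverse_table s) i) == i])
  (iota 0 k).

Lemma act_default s i : size s <= i -> act s i = i.
Proof. exact: nth_default. Qed.

Lemma perm_tableK k s : perm_table k s ->
  cancel (act s) (act (inverse_table s)) /\ cancel (act (inverse_table s)) (act s).
Proof.
move=> /andP[/eqP sz_s /allP s_ok].
have sz_s' : size (inverse_table s) = k by rewrite size_map size_iota.
split=> i; (have [lt_ik|le_ki] := ltnP i k; last by rewrite !act_default ?sz_s ?sz_s').
  by have := s_ok i; rewrite mem_iota => /(_ lt_ik) /and4P[_ _ /eqP ? _].
by have := s_ok i; rewrite mem_iota => /(_ lt_ik) /and4P[_ _ _ /eqP ?].
Qed.

Definition table_sym k s (ok : perm_table k s) : sym nat :=
  Sym (perm_tableK ok).1 (perm_tableK ok).2.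

Definition table_act (x a : seq nat) (w : nword) i :=
  foldr (fun l j => let s := if l.1 == 0 then x else if l.1 == 1%N then a else [::] in
                    act (if l.2 then inverse_table s else s) j) i w.

Definition table_model k (x a : seq nat) (R : seq nword) (u v : nword) :=
  [&& perm_table k x, perm_table k a,
      all (fun r => all (fun i => table_act x a r i == i) (iota 0 k)) R
    & has (fun i => table_act x a (u ++ v) i != table_act x a (v ++ u) i)
        (iota 0 k)].

Lemma table_modelP k x a R u v : table_model k x a R u v ->
  exists (H : groupType) (y : nat -> H),
    model 2 R y /\ ev y u * ev y v <> ev y v * ev y u.
Proof.
case/and4P => x_ok a_ok /allP R_ok /hasP[i _ /eqP uv_i].
pose y j : sym nat :=
  if j == 0 then table_sym x_ok else if j == 1%N then table_sym a_ok else 1.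
have yE w j : sym_fun (ev y w) j = table_act x a w j.
  elim: w => //= -[l b] w <-; rewrite /ev_letter /y /=.
  case: eqP => [_|_]; first by case: b.
  by case: eqP => [_|_]; case: b; rewrite //= ?act_default.
exists (sym nat), y; split; last first.
  move=> e; apply: uv_i; rewrite -!yE.
  by rewrite !ev_cat e.
split=> [[|[|j]] //|r Rr]; apply: sym_eq => j; rewrite yE.
have [lt_jk|le_kj] := ltnP j k.
  by apply/eqP/(allP (R_ok r Rr)); rewrite mem_iota.
have /andP[/eqP sz_x _] := x_ok; have /andP[/eqP sz_a _] := a_ok.
elim: (r) => //= l w -> /=; rewrite act_default //.
by do 2?[case: eqP => _]; case: (l.2);
  rewrite ?size_map ?size_iota ?sz_x ?sz_a.
Qed.

(** The element u of finite order generates a subgroup that v normalizes, and a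
    permutation representation shows that v does not centralize it. *)
Lemma not_circularly_orderable G R k x a u v n m d1 d2 :
    presents G 2 R -> table_model k x a R u v ->
    derives R d1 (flatten (nseq n.+1 u)) ->
    derives R d2 (formal_inv v ++ u ++ v ++ formal_inv (flatten (nseq m u))) ->
  ~ circularly_orderable G.
Proof.
move=> [t [t_mod t_gen t_univ]] /table_modelP[H [y [y_mod uv_y]]] d1P d2P G_co.
have powE j : ev t (flatten (nseq j u)) = ev t u ^+ j.
  by elim: j => //= j IHj; rewrite ev_cat IHj expgS.
have un : ev t u ^+ n.+1 = 1 by rewrite -powE (ev_derives t_mod d1P).
have uv : (ev t v)^-1 * ev t u * ev t v = ev t u ^+ m.
  have := ev_derives t_mod d2P.
  by rewrite !ev_cat !ev_formal_inv powE !mulgA => /divg1_eq.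
have := circularly_orderable_normalized G_co un uv.
move=> /(congr1 (mul (ev t v))); rewrite !mulgA mulgV mul1g => {}uv.
have [f ft] := t_univ H y y_mod.
have fE w : f (ev t w) = ev y w by rewrite ev_gmulf; apply: eq_ev.
by apply: uv_y; rewrite -!fE -!gmulfM uv.
Qed.

Section NotCircularlyOrderable.
Local Open Scope nat_scope.

(** The permutations are t |-> t + 1 and t |-> t / m on Z/n for the relation
    x^-1 a x = a^m. For G3 they come from the matrices (1 1; 0 1) and (1 0; -1 1)
    acting on the nonzero vectors over the field with three elements. There v is
    the inverse of the Garside element x y x, which exchanges x and y and so
    inverts u = y x^-1, and u has order 4 in G3. *)
Lemma listed_not_circularly_orderable k : k \in [:: 2; 3; 5; 6; 8] ->
  ~ circularly_orderable (listed_group k).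
Proof.
rewrite !inE => /or4P[| | |/orP[]] /eqP ->.
- apply: (not_circularly_orderable (k := 3)
    (x := [:: 0; 2; 1]) (a := [:: 1; 2; 0])
    (u := word_of "y") (v := word_of "x") (n := 2) (m := 2)
    (d1 := derivation_of
      [:: ("", 1, false)])
    (d2 := derivation_of
      [:: ("", 0, false); ("", 1, true)])
    (listed_presents (isT : 2 < 10))); by vm_compute.
- apply: (not_circularly_orderable (k := 8)
    (x := [:: 3; 7; 2; 6; 1; 5; 0; 4]) (a := [:: 0; 1; 4; 2; 3; 6; 7; 5])
    (u := word_of "yX") (v := word_of "YXY") (n := 3) (m := 3)
    (d1 := derivation_of
      [:: ("XY", 0, true); ("XYY", 0, true); ("XYYx", 0, true);
         ("XXYX", 0, false); ("XXYXX", 0, false); ("XXYx", 1, true);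
         ("YXY", 0, true); ("YXYY", 0, true); ("YXXYX", 0, false);
         ("YXXYXX", 0, false); ("YXXYx", 1, true); ("YXXY", 0, false);
         ("YX", 0, true); ("xYx", 1, true); ("xYY", 0, true);
         ("xYYx", 1, false); ("xYYXX", 0, true); ("xYYX", 0, true)])
    (d2 := derivation_of
      [:: ("", 0, true); ("x", 0, true); ("xYYX", 0, false);
       ("xYYXX", 0, false); ("xYYx", 1, true); ("xYY", 0, false);
       ("xYx", 1, false); ("YX", 0, false); ("YXXY", 0, true);
       ("YXXYx", 1, false); ("YXXYXX", 0, true); ("YXXYX", 0, true);
       ("YXYY", 0, false); ("YXY", 0, false); ("XXYx", 1, false);
       ("XXYXX", 0, true); ("XXYX", 0, true); ("XYYx", 0, false);
       ("XYY", 0, false); ("XY", 0, false)])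
    (listed_presents (isT : 3 < 10))); by vm_compute.
- apply: (not_circularly_orderable (k := 5)
    (x := [:: 0; 4; 3; 2; 1]) (a := [:: 1; 2; 3; 4; 0])
    (u := word_of "y") (v := word_of "x") (n := 4) (m := 4)
    (d1 := derivation_of
      [:: ("", 1, false)])
    (d2 := derivation_of
      [:: ("", 0, false); ("", 1, true)])
    (listed_presents (isT : 5 < 10))); by vm_compute.
- apply: (not_circularly_orderable (k := 5)
    (x := [:: 0; 3; 1; 4; 2]) (a := [:: 1; 2; 3; 4; 0])
    (u := word_of "y") (v := word_of "x") (n := 4) (m := 2)
    (d1 := derivation_of
      [:: ("", 1, false)])
    (d2 := derivation_of
      [:: ("", 0, false)])
    (listed_presents (isT : 6 < 10))); by vm_compute.
- apply: (not_circularly_orderable (k := 7)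
    (x := [:: 0; 4; 1; 5; 2; 6; 3]) (a := [:: 1; 2; 3; 4; 5; 6; 0])
    (u := word_of "y") (v := word_of "x") (n := 6) (m := 2)
    (d1 := derivation_of
      [:: ("", 1, false)])
    (d2 := derivation_of
      [:: ("", 0, false)])
    (listed_presents (isT : 8 < 10))); by vm_compute.
Qed.

End NotCircularlyOrderable.

(** * Left orders from positive cones *)

Definition positive_cone (G : groupType) (P : G -> Prop) :=
  [/\ ~ P 1, forall g h, P g -> P h -> P (g * h)
    & forall g, g <> 1 -> P g \/ P g^-1].

Lemma left_orderable_cone G :
  left_orderable G <-> exists P : G -> Prop, positive_cone P.
Proof.
split=> [[lt [ltxx lt_tr lt_tot ltM]]|[P [P1 PM P_tot]]].
  exists (lt 1); split=> // [g h g_pos h_pos|g g1].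
    by have := proj1 (ltM g 1 h) h_pos; rewrite mulg1; apply: lt_tr.
  have [g_neg|g_pos] := lt_tot g 1 g1; last by left.
  by right; have := proj1 (ltM g^-1 g 1) g_neg; rewrite mulVg mulg1.
exists (fun g h => P (g^-1 * h)); split=> [g|f g h fg gh|g h ne_gh|f g h].
- by rewrite mulVg.
- by have := PM _ _ fg gh; rewrite -mulgA mulVKg.
- have [|gh|gh] := P_tot (g^-1 * h); [|by left|].
    by move=> /mulg1_eq; rewrite invgK.
  by right; rewrite invgM invgK in gh.
- by rewrite invgM -mulgA mulKg.
Qed.

(** * Free groups are left-orderable *)

Section FreeGroup.
Variable n : nat.
Notation letter := ('I_n * bool)%type.
Implicit Types (l : letter) (u v w : seq letter).

Definition no_cancel l l' := l' != flip l.

Definition reduced_word w := sorted no_cancel w.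

Lemma no_cancel_flip l l' : no_cancel (flip l') (flip l) = no_cancel l l'.
Proof.
rewrite /no_cancel (can_eq (@flipK _)) [l' == _]eq_sym.
by rewrite (can2_eq (@flipK _) (@flipK _)).
Qed.

Lemma push_reduced l w : reduced_word w -> reduced_word (push l w).
Proof.
case: w => //= l' w w_red; case: ifP => [_|/negbT ne]; first exact: path_sorted w_red.
by rewrite /reduced_word /= {1}/no_cancel ne.
Qed.

Lemma push_flip l w : reduced_word w -> push (flip l) (push l w) = w.
Proof.
case: w => [|l' w] /=; first by rewrite flipK eqxx.
case: eqP => [->|_ _] /=; last by rewrite flipK eqxx.
by case: w => //= l2 w /andP[/negbTE-> _].
Qed.

Lemma push_flipK l w : reduced_word w -> push l (push (flip l) w) = w.
Proof. by move=> w_red; rewrite -{1}[l]flipK push_flip. Qed.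

Definition stack u w := foldr (@push _) w u.

Lemma stack_reduced u w : reduced_word w -> reduced_word (stack u w).
Proof. by move=> w_red; elim: u => //= l u; apply: push_reduced. Qed.

Lemma reduced_free_red w : reduced_word (free_red w).
Proof. exact: (@stack_reduced w [::]). Qed.

Lemma stack_id w : reduced_word w -> stack w [::] = w.
Proof.
elim: w => //= l w IHw w_red; rewrite IHw; last exact: path_sorted w_red.
by case: w w_red {IHw} => //= l' w /andP[/negbTE->].
Qed.

(** The free group acts on reduced words by multiplication on the left; this is
    van der Waerden's proof that reduced words represent distinct elements. *)
Lemma stack_pres_eq (u v : word n) w :
  pres_eq [::] u v -> reduced_word w -> stack u w = stack v w.
Proof.
move=> uv; elim: uv w => {u v} //.
- move=> u w w_red; rewrite /stack -[u * _]/(u ++ formal_inv u) /formal_inv.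
  elim/last_ind: u => [|u l IHu] //.
  rewrite map_rcons rev_rcons foldr_cat /= foldr_rcons push_flipK //.
    by rewrite -foldr_cat.
  exact: stack_reduced w_red.
- move=> u u' v v' _ IHu _ IHv w w_red; rewrite /stack !foldr_cat.
  by rewrite -!/(stack _ _) IHv // IHu // stack_reduced.
- by move=> u v _ IH w /IH.
- by move=> u v w _ IHu _ IHv t t_red; rewrite IHu // IHv.
Qed.

Lemma reduced_word_unique (u v : word n) :
  pres_eq [::] u v -> reduced_word u -> reduced_word v -> u = v.
Proof.
by move=> uv u_red v_red; rewrite -[u]stack_id // -[v]stack_id // (stack_pres_eq uv).
Qed.

(** The letter l is the direction in which the edge labelled l leaves a vertex of
    the Cayley tree, and the 2n directions are numbered in the same way at all
    vertices. A path that arrives along l comes from the direction flip l. *)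
Definition direction l : nat := (val l.1).*2 + l.2.

Lemma direction_inj : injective direction.
Proof.
move=> [i b] [j c]; rewrite /direction /= => e.
have ebc : b = c by move/(congr1 odd): e; rewrite !oddD !odd_double !oddb.
by move: e; rewrite ebc => /addIn/double_inj/val_inj ->.
Qed.

Definition turn (d d' : nat) : int := if d < d' then 1%R else (-1)%R.

Lemma turnC d d' : d != d' -> turn d d' = (- turn d' d)%R.
Proof. by rewrite /turn; case: ltngtP. Qed.

Definition bend u v : int :=
  if u is l :: u' then
    if v is l' :: _ then turn (direction (flip (last l u'))) (direction l') else 0%R
  else 0%R.

(** The path of w in the Cayley tree gains 1 at each edge of positive label and at
    each turn to a higher direction, and loses 1 at the others. *)
Fixpoint signature w : int :=
  if w is l :: w' then
    ((if l.2 then -1 else 1) + bend [:: l] w' + signature w')%R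
  else 0%R.

Lemma bend_le1 u v : (-1 <= bend u v <= 1)%R.
Proof. by case: u v => [|l u] [|l' v] //=; rewrite /turn; case: ifP. Qed.

Lemma bend_rcons u l l' v :
  bend (rcons u l) (l' :: v) = turn (direction (flip l)) (direction l').
Proof. by case: u => //= l0 u; rewrite last_rcons. Qed.

Lemma signature_cat u v :
  signature (u ++ v) = (signature u + signature v + bend u v)%R.
Proof.
elim: u => [|l u IHu]; first by rewrite /= add0r addr0.
rewrite cat_cons /= IHu.
by case: u {IHu} => [|l' u] /=; lia.
Qed.

Lemma formal_inv_cons l w : formal_inv (l :: w) = rcons (formal_inv w) (flip l).
Proof. by rewrite /formal_inv /= rev_cons. Qed.

Lemma signature_inv w :
  reduced_word w -> signature (formal_inv w) = (- signature w)%R.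
Proof.
elim: w => [|l w IHw] w_red; first by rewrite /= oppr0.
rewrite formal_inv_cons -cats1 signature_cat IHw; last exact: path_sorted w_red.
have -> : bend (formal_inv w) [:: flip l] = (- bend [:: l] w)%R.
  case: w w_red {IHw} => [|l' w] /=; first by rewrite oppr0.
  move=> /andP[ne _]; rewrite formal_inv_cons bend_rcons flipK; apply: turnC.
  by rewrite (inj_eq direction_inj).
have -> : signature (l :: w) =
    ((if l.2 then -1 else 1) + bend [:: l] w + signature w)%R by [].
by move: (bend _ _) (signature w) => b s /=; case: (l.2) => /=; lia.
Qed.

(** A word has one turn less than letters, so its signature is odd. *)
Lemma signature_neq0 w : w != [::] -> signature w != 0%R.
Proof.
case: w => // l w _; suff [k ->] : exists k : int, signature (l :: w) = (2 * k + 1)%R.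
  by apply/eqP; lia.
elim: w l => [|l' w IHw] l.
  by exists (- (l.2 : nat)%:Z)%R; rewrite /=; case: (l.2).
have [k def_k] := IHw l'.
have -> : signature [:: l, l' & w] = ((if l.2 then -1 else 1) +
    turn (direction (flip l)) (direction l') + signature (l' :: w))%R by [].
rewrite def_k.
exists (k + (if l.2 then -1 else 0) +
        (if (direction (flip l) < direction l')%N then 1 else 0))%R.
by rewrite /turn; case: (l.2); case: ifP; lia.
Qed.

Lemma split_cancel u v : reduced_word u -> reduced_word v ->
  exists p w q, [/\ u = p ++ w, v = formal_inv w ++ q & reduced_word (p ++ q)].
Proof.
elim/last_ind: u v => [|u l IHu] v u_red v_red.
  by exists [::], [::], v.
case: v v_red => [|l' v] v_red.
  by exists (rcons u l), [::], [::]; rewrite cats0.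
have [e|ne] := eqVneq l' (flip l); last first.
  exists (rcons u l), [::], (l' :: v); split; rewrite ?cats0 //.
  case: u u_red {IHu} => [|l0 u] u_red; first by rewrite /= /no_cancel ne.
  move: u_red v_red; rewrite /reduced_word rcons_cons cat_cons /= => u_red v_red.
  by rewrite cat_path u_red last_rcons /= {1}/no_cancel ne.
have u_red' : reduced_word u.
  by move: u_red; rewrite -cats1 => /cat_sorted2[].
have [p [w [q [-> def_v red_pq]]]] := IHu v u_red' (path_sorted v_red).
exists p, (rcons w l), q; split=> //; first by rewrite rcons_cat.
by rewrite /formal_inv map_rcons rev_rcons /= -e def_v.
Qed.

(** The paths form a tripod. The contributions of its three legs cancel, and what
    remains are the turns at the center, between three distinct directions; two
    consecutive turns upward make one turn upward. *)
Lemma signature_product p w q :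
    reduced_word (p ++ w) -> reduced_word (formal_inv w ++ q) ->
    reduced_word (p ++ q) ->
  (signature (p ++ w) + signature (formal_inv w ++ q)
     <= signature (p ++ q) + 1)%R.
Proof.
move=> red_pw red_wq red_pq.
have w_red : reduced_word w by have [] := cat_sorted2 red_pw.
rewrite !signature_cat signature_inv //.
suff : (bend p w + bend (formal_inv w) q - bend p q <= 1)%R.
  by move: (bend p w) (bend _ q) (bend p q) => *; lia.
have [le_b1 le_b2] := (bend_le1, bend_le1).
case/lastP: p red_pw red_pq => [|p l] red_pw red_pq.
  by have /andP[] := le_b1 (formal_inv w) q; rewrite /=; move: (bend _ q); lia.
case: q red_wq red_pq => [|m q] red_wq red_pq.
  have /andP[] := le_b1 (rcons p l) w.
  have -> u : bend u [::] = 0%R by case: u.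
  have -> u : bend u [::] = 0%R by case: u.
  by move: (bend _ w); lia.
case: w red_pw red_wq {w_red} => [|l' w] red_pw red_wq.
  have -> u : bend u [::] = 0%R by case: u.
  rewrite /= !add0r; have /andP[] := le_b1 (rcons p l) (m :: q).
  by move: (bend _ _); lia.
rewrite formal_inv_cons !bend_rcons flipK /turn.
have mid u l1 l2 v : reduced_word (rcons u l1 ++ l2 :: v) -> no_cancel l1 l2.
  case: u => [|l0 u]; first by case/andP.
  by rewrite /= cat_path last_rcons /= => /andP[_ /andP[]].
have lw := mid _ _ _ _ red_pw; have lm := mid _ _ _ _ red_pq.
have wm : no_cancel (flip l') m by move: red_wq; rewrite formal_inv_cons => /mid.
do 3![case: ifP => [|/negbT]]; rewrite -?leqNgt; lia.
Qed.

(** By signature_product, positive elements p w and w^-1 q have a product p q of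
    signature at least 1 + 1 - 1. *)
Definition free_positive (g : presented ([::] : seq (word n * word n))) :=
  exists w : word n, [/\ reduced_word w, g = pres_class _ w & (0 < signature w)%R].

Lemma free_group_left_orderable :
  left_orderable (presented ([::] : seq (word n * word n))).
Proof.
have classM (u v : word n) :
    pres_class [::] u * pres_class [::] v = pres_class [::] (u ++ v).
  by rewrite -[RHS]/(pres_class _ (u * v)) pres_classM.
have class_red g : exists2 w : word n, reduced_word w & g = pres_class [::] w.
  exists (free_red (pres_repr g)); first exact: reduced_free_red.
  by rewrite [RHS]pres_class_ev ev_free_red -pres_class_ev pres_reprK.
apply/left_orderable_cone; exists free_positive; split.
- move=> [w [w_red w1 w_pos]].
  have := @reduced_word_unique w [::] _ w_red isT.
  by move=> w0; rewrite w0 // in w_pos; apply/pres_eq_sym/pres_classP.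
- move=> _ _ [u [u_red -> u_pos]] [v [v_red -> v_pos]].
  have [p [w [q [def_u def_v red_pq]]]] := split_cancel u_red v_red.
  exists (p ++ q); split=> //.
    rewrite classM def_u def_v !(pres_class_ev, ev_cat, ev_formal_inv).
    by rewrite -mulgA mulVKg.
  have := @signature_product p w q.
  rewrite -def_u -def_v => /(_ u_red v_red red_pq).
  by move: u_pos v_pos; move: (signature u) (signature v) (signature _) => *; lia.
- move=> g g1; have [w w_red def_g] := class_red g.
  have w_neq0 : w != [::] by apply/eqP => w0; apply: g1; rewrite def_g w0.
  have inv_red : reduced_word (formal_inv w).
    rewrite /reduced_word /formal_inv rev_sorted sorted_map.
    by apply: sub_sorted w_red => l l' /=; rewrite no_cancel_flip.
  have := signature_neq0 w_neq0; rewrite neq_lt => /orP[w_neg|w_pos]; [right|left].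
    exists (formal_inv w); split=> //; last by rewrite signature_inv // oppr_gt0.
    by rewrite def_g !pres_class_ev ev_formal_inv.
  by exists w.
Qed.

End FreeGroup.

(** * Ascending HNN extensions *)

Definition shift (w : nword) : nword := [seq (l.1.+1, l.2) | l <- w].

(** The group generated by a_0, ..., a_(k-1) with relators E is extended by a
    stable letter, numbered 0, that conjugates a_i to the word psi_i; hence the
    a_i are shifted by one. *)
Definition hnn_relators k (psi E : seq nword) : seq nword :=
  [seq [:: (0, false); (i.+1, false); (0, true)] ++
       formal_inv (shift (nth [::] psi i)) | i <- iota 0 k] ++ map shift E.

Lemma ev_shift (H : groupType) (x : nat -> H) w :
  ev x (shift w) = ev (x \o succn) w.
Proof. exact: ev_map. Qed.

Lemma gmulfXn_group (G H : groupType) (f : {multiplicative G -> H}) g n :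
  f (g ^+ n) = f g ^+ n.
Proof. by elim: n => [|n IHn]; rewrite ?gmulf1_group // !expgS gmulfM IHn. Qed.

Definition left_mul (H : groupType) (h : H) : sym H := Sym (mulKg h) (mulVKg h).

Lemma left_mulM (H : groupType) : {morph @left_mul H : g h / g * h}.
Proof. by move=> g h; apply: sym_eq => t; rewrite /= mulgA. Qed.

(** The base group embeds in H by s, and phi extends psi from the base to an
    automorphism of H: in this way an ascending extension is compared with a
    semidirect product. *)
Section HNN.
Variables (G H : groupType) (k : nat) (psi E : seq nword) (s : nat -> H).
Variables (phi phi' : H -> H).
Hypothesis presG : presents G k.+1 (hnn_relators k psi E).
Hypothesis size_psi : size psi = k.
Hypothesis H_lo : left_orderable H.
Hypothesis s_mod : model k E s.
Hypothesis phiM : {morph phi : g h / g * h}.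
Hypothesis phiK : cancel phi phi'.
Hypothesis phi'K : cancel phi' phi.
Hypothesis phi_s : forall i, i < k -> phi (s i) = ev s (nth [::] psi i).
Hypothesis s_faithful : forall (K : groupType) (b : nat -> K) w,
  model k E b -> ev s w = 1 -> ev b w = 1.

Lemma hnn_model (K : groupType) (t : nat -> K) :
  model k.+1 (hnn_relators k psi E) t <->
  model k E (t \o succn) /\
  forall i, t 0 * t i.+1 * (t 0)^-1 = ev (t \o succn) (nth [::] psi i).
Proof.
have conjE i : ev t ([:: (0, false); (i.+1, false); (0, true)] ++
    formal_inv (shift (nth [::] psi i))) = 1 <->
    t 0 * t i.+1 * (t 0)^-1 = ev (t \o succn) (nth [::] psi i).
  rewrite ev_cat ev_formal_inv ev_shift /= /ev_letter /= mulg1 !mulgA.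
  by split=> [/divg1_eq|->] //; rewrite mulgV.
split=> [[t1 tR]|[[t1 tE] conj_t]].
  have tE : model k E (t \o succn).
    split=> [i le_ki|e Ee]; first exact: t1.
    by rewrite -ev_shift; apply: tR; rewrite mem_cat map_f ?orbT.
  split=> // i; have [lt_ik|le_ki] := ltnP i k.
    apply/conjE/tR; rewrite mem_cat; apply/orP; left; apply/mapP.
    by exists i; rewrite // mem_iota.
  by rewrite nth_default ?size_psi // (t1 i.+1) //= mulg1 mulgV.
split=> [[//|i]|r]; first exact: t1.
rewrite mem_cat => /orP[] /mapP[]; first by move=> i _ ->; apply/conjE.
by move=> e Ee ->; rewrite ev_shift tE.
Qed.

Let Phi : sym H := Sym phiK phi'K.

(** G acts on the set H: the stable letter by phi, the base by multiplication on
    the left. *)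
Let perms i : sym H := if i is j.+1 then left_mul (s j) else Phi.

Lemma ev_perms w : ev (perms \o succn) w = left_mul (ev s w).
Proof.
exact/esym/(ev_gmulf (multiplicative_of (@left_mulM H)) s w).
Qed.

Lemma Phi_conj h : Phi * left_mul h * Phi^-1 = left_mul (phi h).
Proof. by apply: sym_eq => t; rewrite /= phiM phi'K. Qed.

Lemma Phi_conjV h : Phi^-1 * left_mul h * Phi = left_mul (phi' h).
Proof. by apply: sym_eq => t; rewrite /= -{1}[h]phi'K -phiM phiK. Qed.

Lemma perms_model : model k.+1 (hnn_relators k psi E) perms.
Proof.
have left1 : left_mul (1 : H) = 1 by apply: sym_eq => t; rewrite /= mul1g.
apply/hnn_model; split=> [|i].
  split=> [i le_ki|e Ee]; first by rewrite /= s_mod.1.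
  by rewrite ev_perms s_mod.2.
rewrite ev_perms /= Phi_conj; congr left_mul.
have [lt_ik|le_ki] := ltnP i k; first exact: phi_s.
rewrite nth_default ?size_psi // s_mod.1 //=.
by apply: (mulgI (phi 1)); rewrite -phiM !mulg1.
Qed.

(** The exponent sum of the stable letter. *)
Let heights i : infinite_cyclic := if i is 0 then 1%R : int else 1.

Lemma heights_model : model k.+1 (hnn_relators k psi E) heights.
Proof.
have ev1 w : ev (heights \o succn) w = 1.
  elim: w => //= -[i b] w ->; rewrite /ev_letter /=.
  by case: b; rewrite ?invg1 mulg1.
by apply/hnn_model; split=> // i; rewrite ev1.
Qed.

Section Embedding.
Variable t : nat -> G.
Hypothesis t_mod : model k.+1 (hnn_relators k psi E) t.
Hypothesis t_gen : forall g, exists w, g = ev t w.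
Let x := t 0.
Let a := t \o succn.

Lemma conj_power w N : exists v, x ^+ N * ev a w * x ^- N = ev a v.
Proof.
have [_ conj_a] := (hnn_model t).1 t_mod.
have conj1 v : x * ev a v * x^-1 = ev a (subst psi v).
  rewrite ev_subst; elim: v => [|[i b] v IHv] /=; first by rewrite mulg1 mulgV.
  rewrite -IHv /ev_letter /= -[ev _ (nth _ _ _)]conj_a -/x.
  by case: b; rewrite ?invgM ?invgK !mulgA mulgVK.
elim: N => [|N [v IHN]]; first by exists w; rewrite mul1g divg1.
exists (subst psi v); rewrite -conj1 -IHN.
by rewrite expgS invgM !mulgA.
Qed.

(** Conjugation by x maps the subgroup generated by a into itself, so negative
    powers of x can be collected on the left, and positive powers on the right. *)
Lemma hnn_normal_form g :
  exists N M w, g = x ^- N * ev a w * x ^+ M.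
Proof.
have [w0 ->] := t_gen g; elim: w0 => [|[[|i] b] w0 [N [M [w IHw]]]].
- by exists 0, 0, [::]; rewrite /= invg1 !mulg1.
- rewrite /= IHw /ev_letter /= -/x; case: b.
    by exists N.+1, M, w; rewrite expgSr invgM !mulgA.
  case: N {IHw} => [|N]; last first.
    by exists N, M, w; rewrite expgSr invgM !mulgA mulgV mul1g.
  have [v def_v] := conj_power w 1.
  exists 0, M.+1, v; rewrite -def_v expg1 !invg1 !mul1g expgS !mulgA.
  by rewrite mulgVK.
- have [v def_v] := conj_power [:: (i, b)] N.
  exists N, M, (v ++ w); rewrite ev_cat -def_v /= IHw mulg1 !mulgA.
  by rewrite mulVg mul1g.
Qed.

Variables (f : {multiplicative G -> sym H}).
Variables (hgt : {multiplicative G -> infinite_cyclic}).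
Hypothesis ft : forall i, f (t i) = perms i.
Hypothesis ht : forall i, hgt (t i) = heights i.

Lemma f_ev w : f (ev a w) = left_mul (ev s w).
Proof. by rewrite ev_gmulf -ev_perms; apply: eq_ev => i; apply: ft. Qed.

Lemma hgt_normal_form N M w :
  hgt (x ^- N * ev a w * x ^+ M) = (M%:Z - N%:Z)%R.
Proof.
have powE n : hgt (x ^+ n) = n%:Z%R.
  elim: n => [|n IHn]; first exact: gmulf1_group.
  by rewrite expgS gmulfM IHn ht -[RHS](PoszD 1%N n).
have evE : hgt (ev a w) = 1.
  rewrite ev_gmulf; elim: w => //= -[i b] w ->; rewrite /ev_letter /= ht.
  by case: b; rewrite /= ?invg1 mulg1.
rewrite !gmulfM evE mulg1 gmulfV_group !powE; exact: addrC.
Qed.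

(** An element of height 0 is conjugate under a power of x to an element of the
    base, so it acts by a translation of H, and faithfully. *)
Lemma hnn_kernel g : hgt g = 1 ->
  exists2 h, f g = left_mul h & (h = 1 -> g = 1).
Proof.
have [N [M [w ->]]] := hnn_normal_form g; move/esym.
rewrite hgt_normal_form => NM.
have {M NM} -> : M = N by move: NM => /eqP; rewrite eq_sym subr_eq0 => /eqP[].
have phi'1 h : phi' h = 1 -> h = 1.
  move=> /(congr1 phi); rewrite phi'K => ->.
  by apply: (mulgI (phi 1)); rewrite -phiM !mulg1.
exists (iter N phi' (ev s w)).
  rewrite !gmulfM f_ev gmulfV_group gmulfXn_group ft /=.
  elim: N => [|N IHN]; first by rewrite !expg0 invg1 mul1g mulg1.
  by rewrite iterS -Phi_conjV -IHN expgSr invgM !mulgA.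
move=> h1; have -> : ev a w = 1.
  apply: s_faithful; first by have [] := (hnn_model t).1 t_mod.
  by elim: N h1 => //= N IHN /phi'1.
by rewrite mulg1 mulVg.
Qed.

End Embedding.

(** Lexicographic order: first the height, then the translation by which an
    element of height 0 acts. *)
Lemma hnn_left_orderable : left_orderable G.
Proof.
have [t [t_mod t_gen t_univ]] := presG.
have [f ft] := t_univ _ _ perms_model; have [hgt ht] := t_univ _ _ heights_model.
have /left_orderable_cone[PH [PH1 PHM PH_tot]] := H_lo.
have ker := hnn_kernel t_mod t_gen ft ht.
pose P g := (0 < (hgt g : int))%R \/
  hgt g = 1 /\ exists2 h, f g = left_mul h & PH h.
have left_inj (h h' : H) : left_mul h = left_mul h' -> h = h'.
  by move=> /(congr1 (fun u => sym_fun u 1)); rewrite /= !mulg1.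
apply/left_orderable_cone; exists P; split.
- case=> [|[_ [h]]]; first by rewrite gmulf1_group ltxx.
  rewrite gmulf1_group => h1; suff -> : h = 1 by [].
  by apply: left_inj; rewrite -h1; apply: sym_eq => u; rewrite /= mul1g.
- move=> g g' [g_pos|[g0 [h fg h_pos]]] [g'_pos|[g'0 [h' fg' h'_pos]]].
  + by left; rewrite gmulfM; apply: addr_gt0.
  + by left; rewrite gmulfM g'0 mulg1.
  + by left; rewrite gmulfM g0 mul1g.
  + right; split; first by rewrite gmulfM g0 g'0 mulg1.
    by exists (h * h'); rewrite ?gmulfM ?fg ?fg' ?left_mulM //; apply: PHM.
- move=> g g1; have [g_pos|g_neg|g0] := ltgtP 0%R (hgt g : int).
  + by left; left.
  + by right; left; rewrite gmulfV_group; rewrite -oppr_lt0 opprK.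
  + have {}g0 : hgt g = 1 by rewrite -g0.
    have [h fg hP] := ker g g0.
    have h1 : h <> 1 by move=> /hP.
    have [h_pos|h_neg] := PH_tot h h1; [left|right]; right.
      by split=> //; exists h.
    split; first by rewrite gmulfV_group g0 invg1.
    exists h^-1 => //; rewrite gmulfV_group fg.
    by apply/sym_eq.
Qed.

End HNN.

(** * The left-orderable groups of the list *)

(** Here the base is a free group and psi is invertible, so H is the base. *)
Lemma free_by_cyclic_left_orderable G n psi psi' :
    presents G n.+1 (hnn_relators n psi [::]) ->
    size psi = n -> size psi' = n ->
    all (fun i => free_red (subst psi' (nth [::] psi i)) == letter_word i)
      (iota 0 n) ->
    all (fun i => free_red (subst psi (nth [::] psi' i)) == letter_word i)
      (iota 0 n) ->
  left_orderable G.
Proof.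
move=> presG sz_psi sz_psi' psiK psi'K.
pose F : groupType := presented ([::] : seq (word n * word n)).
have [s [s_mod s_gen s_univ]] : presents F n [::].
  exact: presented_presents [::].
have endo q : size q = n -> exists f : {multiplicative F -> F},
    forall i, f (s i) = ev s (nth [::] q i).
  by move=> sz_q; apply: s_univ; split=> // i le_ni; rewrite nth_default ?sz_q.
have [phi phi_s] := endo psi sz_psi; have [phi' phi'_s] := endo psi' sz_psi'.
have inv q q' (f f' : {multiplicative F -> F}) :
    (forall i, f (s i) = ev s (nth [::] q i)) ->
    (forall i, f' (s i) = ev s (nth [::] q' i)) -> size q = n ->
    all (fun i => free_red (subst q' (nth [::] q i)) == letter_word i)
      (iota 0 n) -> cancel f f'.
  move=> fs f's sz_q qK u; have [w ->] := s_gen u; rewrite !ev_gmulf.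
  apply: eq_ev => i /=; rewrite fs ev_gmulf.
  rewrite (eq_ev _ (f's : f' \o s =1 _)) -ev_subst -ev_free_red.
  have [lt_in|le_ni] := ltnP i n.
    by rewrite (eqP (allP qK i _)) ?mem_iota //= /ev_letter mulg1.
  by rewrite nth_default ?sz_q // s_mod.1.
apply: (hnn_left_orderable presG sz_psi (free_group_left_orderable n) s_mod
  (phi := phi) (phi' := phi')).
- exact: gmulfM.
- exact: inv psiK.
- exact: inv psi'K.
- by move=> i _; apply: phi_s.
- move=> K b w b_mod sw1; have [f fs] := s_univ K b b_mod.
  by rewrite -(eq_ev _ (fs : f \o s =1 b)) -ev_gmulf sw1 gmulf1_group.
Qed.

Definition additive_group (V : zmodType) : Type := V.

HB.instance Definition _ V := Choice.on (additive_group V).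
HB.instance Definition _ (V : zmodType) := isGroup.Build (additive_group V)
  (@addrA V) (@add0r V) (@addr0 V) (@addNr V) (@addrN V).

Definition plane : groupType := additive_group (rat * rat)%type.

(** Lexicographic order. *)
Lemma plane_left_orderable : left_orderable plane.
Proof.
apply/left_orderable_cone.
exists (fun v : rat * rat => (0 < v.1)%R \/ v.1 = 0%R /\ (0 < v.2)%R); split.
- by move=> [|[_]] /=; rewrite ltxx.
- move=> [p q] [p' q'] /= [p_gt0|[-> q_gt0]] [p'_gt0|[-> q'_gt0]].
  + by left; apply: addr_gt0.
  + by left; rewrite /= addr0.
  + by left; rewrite /= add0r.
  + by right; rewrite /= addr0; split=> //; apply: addr_gt0.
- move=> [p q] /= ne0; have [p_pos|p_neg|p0] := ltgtP 0%R p.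
  + by left; left.
  + by right; left; rewrite oppr_gt0.
  have [q_pos|q_neg|q0] := ltgtP 0%R q.
  + by left; right; rewrite p0.
  + by right; right; rewrite -p0 oppr0 oppr_gt0.
  + by case: ne0; rewrite -p0 -q0.
Qed.

Definition exponent_sum (i : nat) (w : nword) : int :=
  ev (fun j => (j == i : nat)%:Z%R : infinite_cyclic) w.

Lemma exponent_sum_cons i l w :
  exponent_sum i (l :: w) =
  ((if l.2 then - (l.1 == i : nat)%:Z else (l.1 == i : nat)%:Z) + exponent_sum i w)%R.
Proof. by rewrite /exponent_sum /= /ev_letter; case: (l.2). Qed.

Lemma commute_zpow (G : groupType) (g h : G) m :
  commute g h -> commute g (zpow h m).
Proof.
by move=> gh; case: m => j; [apply: commuteX|apply/commuteV/commuteX].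
Qed.

Lemma ev_commute (G : groupType) (b : nat -> G) w :
    (forall i, 1 < i -> b i = 1) -> commute (b 1%N) (b 0) ->
  ev b w = zpow (b 0) (exponent_sum 0 w) * zpow (b 1%N) (exponent_sum 1 w).
Proof.
move=> b1 b10; elim: w => [|[i c] w IHw]; first by rewrite /= mulg1.
have zpow_letter (g : G) (d : bool) m :
    zpow g ((if d then - 1%:Z else 1%:Z) + m)%R = (if d then g^-1 else g) * zpow g m.
  by rewrite zpowD; case: d.
rewrite !exponent_sum_cons /= IHw /ev_letter /=.
case: i => [|[|i]] /=.
- by rewrite zpow_letter mulgA (_ : (if c then _ else _) = 0%R) ?add0r //; case: c.
- rewrite zpow_letter (_ : (if c then _ else _) = 0%R) ?add0r ?mulgA; last by case: c.
  congr (_ * _); case: c; apply: commute_zpow => //.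
  exact/commute_sym/commuteV/commute_sym.
- rewrite b1 // invg1 if_same mul1g (_ : (if c then _ else _) = 0%R) ?add0r //.
  by case: c.
Qed.

Lemma ev_plane (s : nat -> plane) w i (p : {additive rat * rat -> rat}) :
    (forall j, p (s j) = ((j == i : nat)%:Z)%:~R%R) ->
  p (ev s w) = (exponent_sum i w)%:~R%R.
Proof.
move=> ps; elim: w => [|[j c] w IHw]; first exact: raddf0.
rewrite exponent_sum_cons [ev _ _]/= [p _]raddfD IHw rmorphD /=; congr (_ + _)%R.
by rewrite /ev_letter /=; case: c; rewrite ?[p _]raddfN ps //= rmorphN.
Qed.

(** BS(1, 2): its base is generated by one element, and embeds in Q, the first
    factor of the plane. *)
Lemma doubling_left_orderable G :
  presents G 2 (hnn_relators 1 [:: word_of "xx"] [::]) -> left_orderable G.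
Proof.
move=> presG; pose e : rat * rat := (1, 0)%R.
pose s (i : nat) : plane := if i is 0 then e else 0%R.
apply: (hnn_left_orderable (s := s) (phi := fun v : rat * rat => (v + v)%R)
  (phi' := fun v : rat * rat => (v.1 / 2%:R, v.2 / 2%:R)%R) presG _
  plane_left_orderable).
- by [].
- by split=> // -[|i].
- by move=> u v; apply: addrACA.
- by move=> [p q]; rewrite /=; congr (_, _); field.
- by move=> [p q]; rewrite /=; congr (_, _); rewrite /=; field.
- by case=> // _; apply/eqP; vm_compute.
- move=> K b w [b1 _] sw1; have b11 : b 1%N = 1 by apply: b1.
  have /esym/eqP : fst (ev s w) = (exponent_sum 0 w)%:~R%R.
    by apply: ev_plane => -[|j].
  rewrite sw1 intr_eq0 => /eqP e0.
  rewrite ev_commute => [|i i_gt1|]; last by rewrite b11; apply/commute_sym/commute1.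
    rewrite e0 b11 mul1g; case: (exponent_sum 1 w) => j /=;
    by rewrite expg1n ?invg1.
  by apply: b1; apply: ltnW.
Qed.

(** The base is Z^2, and the stable letter acts by the companion matrix of
    t^2 - 2 t + 2, of determinant 2, which is invertible over Q. *)
Lemma gaussian_left_orderable G :
    presents G 3 (hnn_relators 2 [:: word_of "y"; word_of "yyXX"]
                    [:: word_of "xyXY"]) ->
  left_orderable G.
Proof.
move=> presG.
pose s (i : nat) : plane :=
  if i is 0 then (1, 0)%R else if i is 1%N then (0, 1)%R else 0%R.
apply: (hnn_left_orderable (s := s)
  (phi := fun v : rat * rat => (- v.2 - v.2, v.1 + v.2 + v.2)%R)
  (phi' := fun v : rat * rat => (v.1 + v.2, - v.1 / 2%:R)%R) presG _
  plane_left_orderable).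
- by [].
- split=> [[|[|i]] //|r]; rewrite inE => /eqP ->.
  by apply/eqP; vm_compute.
- move=> [p q] [p' q']; congr (_, _); rewrite /=; ring.
- by move=> [p q]; rewrite /=; congr (_, _); field.
- by move=> [p q]; rewrite /=; congr (_, _); field.
- by move=> [|[|i]] // _; apply/eqP; vm_compute.
- move=> K b w [b1 bE] sw1.
  have /esym/eqP : fst (ev s w) = (exponent_sum 0 w)%:~R%R.
    by apply: ev_plane => -[|[|j]].
  rewrite sw1 intr_eq0 => /eqP e0.
  have /esym/eqP : snd (ev s w) = (exponent_sum 1 w)%:~R%R.
    by apply: ev_plane => -[|[|j]].
  rewrite sw1 intr_eq0 => /eqP e1.
  rewrite ev_commute => [|i i_gt1|]; first by rewrite e0 e1 mulg1.
    exact: b1.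
  have := bE _ (mem_head _ _).
  have -> : word_of "xyXY" =
    [:: (0, false); (1%N, false); (0, true); (1%N, true)] by vm_compute.
  rewrite /= /ev_letter /= mulg1 !mulgA => /divg1_eq/(canRL (mulgVK _)).
  by rewrite /commute => ->.
Qed.

Local Open Scope nat_scope.

(** The new generators are x, y x^-1 and, where a second one is needed, the
    conjugate x y x^-2 of y x^-1 by x. They are numbered from the letter x. *)
Definition hnn_certificate (alpha : seq String.string)
    (d1 d2 d4 : seq (seq (String.string * nat * bool))) :=
  Certificate (map word_of alpha) [:: word_of "x"; word_of "yx"]
    (map derivation_of d1) (map derivation_of d2) [:: [::]; [::]]
    (map derivation_of d4).

Lemma infinite_cyclic_left_orderable : left_orderable infinite_cyclic.
Proof.
apply/left_orderable_cone; exists (fun m : int => 0 < m)%R; split=> //.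
- by move=> m m'; apply: addr_gt0.
- move=> m m1; have [m_pos|m_neg|m0] := ltgtP 0%R (m : int).
  + by left.
  + by right; rewrite oppr_gt0.
  + by case: m1; rewrite -m0.
Qed.

(** In psi and psi' the letters x and y are a_0 and a_1; in the derivations from
    the new relators x is the stable letter, and y and z are a_0 and a_1. *)
Lemma listed_left_orderable k : k \in [:: 0; 1; 4; 7; 9] ->
  left_orderable (listed_group k).
Proof.
rewrite !inE => /or4P[| | |/orP[]] /eqP ->.
- exact: infinite_cyclic_left_orderable.
- apply: (free_by_cyclic_left_orderable (n := 2)
    (psi := [:: word_of "y"; word_of "Xy"])
    (psi' := [:: word_of "xY"; word_of "x"])
    (certified_presents (C := hnn_certificate [:: "x"; "yX"; "xyXX"]
      [:: [::]; [:: ("xY", 0, true)]]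
      [:: [:: ("xyxYX", 0, true); ("xyZX", 1, true); ("", 0, false)]]
      [:: [::]; [::]; [:: ("", 0, false)]])
      _ (listed_presents (isT : 1 < 10)))); by vm_compute.
- apply: (free_by_cyclic_left_orderable (n := 2)
    (psi := [:: word_of "y"; word_of "yXyy"])
    (psi' := [:: word_of "xxYx"; word_of "x"])
    (certified_presents (C := hnn_certificate [:: "x"; "yX"; "xyXX"]
      [:: [::]; [:: ("xxyXYxY", 0, false)]]
      [:: [:: ("XyZ", 0, true); ("XzzxZX", 1, false); ("Xz", 0, true);
       ("X", 0, true); ("yyZ", 0, false)]]
      [:: [::]; [::]; [:: ("", 0, false)]])
      _ (listed_presents (isT : 4 < 10)))); by vm_compute.
- apply: (doubling_left_orderable
    (certified_presents (C := hnn_certificate [:: "x"; "yX"]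
      [:: [:: ("y", 0, true)]]
      [:: [:: ("XY", 0, true)]]
      [:: [::]; [::]])
      _ (listed_presents (isT : 7 < 10)))); by vm_compute.
- apply: (gaussian_left_orderable
    (certified_presents (C := hnn_certificate [:: "x"; "yX"; "xyXX"]
      [:: [::]; [:: ("xxyXXX", 0, true); ("xxyXXXyx", 1, false);
       ("xxyXXY", 0, true); ("xxyX", 1, false); ("xxyXYX", 0, true)];
       [:: ("yyXYxx", 1, true); ("yyXYxY", 0, false)]]
      [:: [:: ("xyxYX", 0, true); ("xyZX", 0, false); ("xZ", 2, true);
         ("xZX", 0, false); ("xZX", 1, true)]; [:: ("XXYxyxYX", 0, true);
         ("XXYxZ", 2, true); ("XXYxZX", 1, true); ("XXyZZ", 0, false);
         ("XXyZY", 2, true); ("XXZ", 0, false)]]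
      [:: [::]; [::]; [:: ("", 0, false)]])
      _ (listed_presents (isT : 9 < 10)))); by vm_compute.
Qed.

Theorem theorem4p6 (G : groupType) (hG : green_table_group G) :
  (left_orderable G ->
     isomorphic G infinite_cyclic \/ isomorphic G G1 \/ isomorphic G G4 \/
     isomorphic G G7 \/ isomorphic G G9) /\
  (~ left_orderable G ->
     ~ circularly_orderable G /\
     (isomorphic G G2 \/ isomorphic G G3 \/ isomorphic G G5 \/
      isomorphic G G6 \/ isomorphic G G8)).
Proof.
have [D [D_le4 GD]] := hG.
have sz_le4 : size (knot_code D) <= 4 by rewrite size_knot_code.
have [k lt10 Dk] := table_classifies table_checked (knot_code_valid D) sz_le4
  (knot_code_presents D).
have {GD Dk} Gk : isomorphic G (listed_group k).
  exact: isomorphic_trans GD (presents_isomorphic Dk (listed_presents lt10)).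
have [k_lo|k_nlo] := boolP (k \in [:: 0; 1; 4; 7; 9]).
  have G_lo : left_orderable G.
    apply: isomorphic_left_orderable (listed_left_orderable k_lo).
    exact: isomorphic_sym.
  split=> // _; move: k_lo Gk; rewrite !inE.
  by case/or4P => [| | |/orP[]] /eqP ->; tauto.
have k_nco : k \in [:: 2; 3; 5; 6; 8].
  by move: k lt10 k_nlo {Gk}; do 10?[case=> //].
have G_nco : ~ circularly_orderable G.
  move=> /(isomorphic_circularly_orderable Gk).
  exact: listed_not_circularly_orderable.
split=> [/left_orderable_circularly //|_]; split=> //.
move: k_nco Gk; rewrite !inE.
by case/or4P => [| | |/orP[]] /eqP ->; tauto.
Qed.
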